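(* Let $p$ be an odd prime, let $n\ge 3$ be an odd integer, and let $f:\mathbb{F}_p^n\to\mathbb{F}_p$ be a non-weakly regular bent function belonging to $\mathcal{DBF}$. If $p\equiv1\pmod4$, assume that $B_-(f)$ and $B_-(f^* )$ are both non-degenerate $r$-dimensional subspaces over $\mathbb{F}_p$; if $p\equiv3\pmod 4$, assume that $B_+(f)$ and $B_-(f^* )$ are both non-degenerate $r$-dimensional subspaces over $\mathbb{F}_p$. (i) If $r=\frac{n+1}2$ and $p\equiv1\pmod4$, then $$U_{14}=\{\{0\},\ c_0(f),c_1(f),\dots,c_{p-1}(f),\ d_0(f)\setminus\{0\},\ d_{n_1}(f),d_{n_2}(f),\dots,d_{n_{(p-1)/2}}(f)\}$$ is a partition of $\mathbb{F}_p^n$ and induces a $\frac{3p+1}2$-class symmetric association scheme. (ii) If $r=\frac{n+1}2$ and $p\equiv3\pmod4$, then $$U_{15}=\{\{0\},\ c_0(f),c_1(f),\dots,c_{p-1}(f),\ d_0(f)\setminus\{0\},\ d_{s_1}(f),d_{s_2}(f),\dots,d_{s_{(p-1)/2}}(f)\}$$ is a partition of $\mathbb{F}_p^n$ and induces a $\frac{3p+1}2$-class symmetric association scheme. (iii) If $\frac{n+1}2<r\le n-1$ and $p\equiv1\pmod4$, then $$U_{16}=\{\{0\},\ c_0(f),c_1(f),\dots,c_{p-1}(f),\ B_-(f)^\bot\setminus\{0\},\ d_0(f)\setminus B_-(f)^\bot,\ d_1(f),\dots,d_{p-1}(f)\}$$ is a partition of $\mathbb{F}_p^n$ and induces a $(2p+1)$-class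 symmetric association scheme. (iv) If $\frac{n+1}2<r\le n-1$ and $p\equiv3\pmod4$, then $$U_{17}=\{\{0\},\ c_0(f),c_1(f),\dots,c_{p-1}(f),\ B_+(f)^\bot\setminus\{0\},\ d_0(f)\setminus B_+(f)^\bot,\ d_1(f),\dots,d_{p-1}(f)\}$$ is a partition of $\mathbb{F}_p^n$ and induces a $(2p+1)$-class symmetric association scheme.
   Context: Let $p$ be an odd prime, $n$ a positive integer, $x\cdot y$ the ordinary inner product on $\mathbb{F}_p^n$, and $\xi_p=e^{2\pi\sqrt{-1}/p}$. $SQ=\{s_1<s_2<\dots<s_{(p-1)/2}\}$ and $NSQ=\{n_1<n_2<\dots<n_{(p-1)/2}\}$ denote the sets of squares and of nonsquares in $\mathbb{F}_p^*=\{1,\dots,p-1\}$. Bent functions. For $f:\mathbb{F}_p^n\to\mathbb{F}_p$ the Walsh transform is $\mathcal{W}_f(\alpha)=\sum_{x\in\mathbb{F}_p^n}\xi_p^{f(x)-\alpha\cdot x}$, $\alpha\in\mathbb{F}_p^n$; $f$ is bent if $|\mathcal{W}_f(\alpha)|=p^{n/2}$ for all $\alpha$. Put $\mu=1$ if $p^n\equiv1\pmod 4$ and $\mu=\sqrt{-1}$ if $p^n\equiv3\pmod4$. For a bent $f$ it is known that for every $\alpha$, $\mathcal{W}_f(\alpha)\in\{\mu p^{n/2}\xi_p^{f^*(\alpha)},-\mu p^{n/2}\xi_p^{f^*(\alpha)}\}$ for a (unique) function $f^*:\mathbb{F}_p^n\to\mathbb{F}_p$, called the dual of $f$. A bent $f$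 is weakly regular if there is $\lambda\in\{\pm1,\pm\sqrt{-1}\}$ independent of $\alpha$ with $\mathcal{W}_f(\alpha)=\lambda p^{n/2}\xi_p^{f^*(\alpha)}$ for all $\alpha$; otherwise it is non-weakly regular. A bent $f$ is dual-bent if $f^*$ is also bent. For a bent function $f$: $B_+(f)=\{\alpha:\mathcal{W}_f(\alpha)=\mu p^{n/2}\xi_p^{f^*(\alpha)}\}$ and $B_-(f)=\{\alpha:\mathcal{W}_f(\alpha)=-\mu p^{n/2}\xi_p^{f^*(\alpha)}\}$. For $f$ dual-bent, $B_\pm(f^* )$ are defined by the same formulas applied to the bent function $f^*$. For dual-bent $f$ and $j\in\mathbb{F}_p$: $c_j(f)=\{x\in B_+(f^* ):f(x)=j\}$, $d_j(f)=\{x\in B_-(f^* ):f(x)=j\}$. $\mathcal{DBF}$ is the set of dual-bent functions $f:\mathbb{F}_p^n\to\mathbb{F}_p$ such that $f(0)=0$ and there is a positive integer $h$ with $\gcd(h-1,p-1)=1$ and $f(ax)=a^hf(x)$ for all $a\in\mathbb{F}_p^*$, $x\in\mathbb{F}_p^n$. For a subspace $V$ of $\mathbb{F}_p^n$, $V^\bot$ is its orthogonal complement with respect to $\cdot$; $V$ is non-degenerate if $\{x\in V:x\cdot y=0\ \text{for all } y\in V\}=\{0\}$. Association schemes. A $d$-class association scheme on a nonempty finite set $X$ is a partition of $X\times X$ into relations $R_0,\dots,R_d$ such that $R_0=\{(x,x):x\in X\}$; for each $j$ the transpose $R_j^T$ equals some $R_{j'}$; and for all $u,v,w$ and $(x,y)\in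 R_w$ the number $|\{z\in X:(x,z)\in R_u,(z,y)\in R_v\}|$ depends only on $u,v,w$. It is symmetric if $R_j^T=R_j$ for all $j$. A partition $\{U_i\}_{i=0}^d$ of $\mathbb{F}_p^n$ (into nonempty sets) with $U_0=\{0\}$ induces a $d$-class symmetric association scheme if the relations $R_i=\{(\alpha,\beta):\alpha-\beta\in U_i\}$, $0\le i\le d$, form a symmetric association scheme on $\mathbb{F}_p^n$. *)

(* Defs.v *)
From HB Require Import structures.
From mathcomp Require Import all_boot all_order all_algebra.
From mathcomp Require Import complex.
From mathcomp Require Import reals trigo.

Set Implicit Arguments.
Unset Strict Implicit.
Unset Printing Implicit Defensive.

Import Order.TTheory GRing.Theory Num.Theory.
Local Open Scope ring_scope.

Section AssociationSchemes.

Definition assoc_scheme (X : finType) (d : nat)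
    (Rel : 'I_d.+1 -> {set X * X}) : Prop :=
  [/\ [/\ (0 < #|X|)%N,
          forall i, Rel i != set0,
          forall i j, i != j -> [disjoint Rel i & Rel j] &
          \bigcup_i Rel i = [set: X * X]],
      Rel ord0 = [set xy : X * X | xy.1 == xy.2],
      forall j, exists j', [set xy : X * X | (xy.2, xy.1) \in Rel j] = Rel j' &
      exists c : 'I_d.+1 -> 'I_d.+1 -> 'I_d.+1 -> nat,
        forall u v w x y, (x, y) \in Rel w ->
          #|[set z | ((x, z) \in Rel u) && ((z, y) \in Rel v)]| = c u v w].

Definition sym_assoc_scheme (X : finType) (d : nat)
    (Rel : 'I_d.+1 -> {set X * X}) : Prop :=
  assoc_scheme Rel /\
  forall j, [set xy : X * X | (xy.2, xy.1) \in Rel j] = Rel j.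

(* The blocks of P are labelled injectively by 0, ..., d, with {0} labelled 0;
   in particular P has exactly d + 1 blocks. *)
Definition induces_sym_scheme (V : finZmodType) (d : nat) (P : {set {set V}}) :
    Prop :=
  exists U : 'I_d.+1 -> {set V},
    [/\ injective U,
        P = [set U i | i : 'I_d.+1],
        U ord0 = [set 0] &
        sym_assoc_scheme
          (fun i => [set ab : V * V | ab.1 - ab.2 \in U i])].

End AssociationSchemes.

Section Subspaces.
Variables (F : finFieldType) (n : nat).
Implicit Types (B : {set 'rV[F]_n}).

Definition dot (x y : 'rV[F]_n) : F := \sum_i x 0 i * y 0 i.

Definition orth B : {set 'rV[F]_n} :=
  [set x | [forall y in B, dot x y == 0]].

Definition nondeg_subspace (r : nat) B : Prop :=
  (exists V : {vspace 'rV[F]_n}, B = [set x in V] /\ \dim V = r) /\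
  B :&: orth B = [set 0].

End Subspaces.

Definition SQ (p : nat) : {set 'F_p} :=
  [set a | (a != 0) && [exists b, a == b ^+ 2]].

Definition NSQ (p : nat) : {set 'F_p} :=
  [set a | (a != 0) && ~~ [exists b, a == b ^+ 2]].

Section BentFunctions.
Variables (R : realType) (p n : nat).
Implicit Types (f : 'rV['F_p]_n -> 'F_p).

Definition xi : R[i] :=
  (cos (pi *+ 2 / p%:R) +i* sin (pi *+ 2 / p%:R))%C.

(* In xi ^+ a with a : 'F_p, the exponent is the representative of a in
   {0, ..., p - 1}. *)
Definition walsh f (alpha : 'rV['F_p]_n) : R[i] :=
  \sum_(x : 'rV['F_p]_n) xi ^+ (f x - dot alpha x)%R.

(* p^(n/2) *)
Definition sqrt_pn : R[i] := (Num.sqrt (p%:R ^+ n : R))%:C%C.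

Definition mu : R[i] := if p ^ n == 1 %[mod 4] then 1 else 'i%C.

Definition bent f : Prop := forall alpha, `|walsh f alpha| = sqrt_pn.

(* The dual f^*.  When f is bent (p an odd prime) the value searched for exists
   and is unique; the default value 0 is never used in that case. *)
Definition dual f : 'rV['F_p]_n -> 'F_p := fun alpha =>
  odflt 0 [pick j : 'F_p | (walsh f alpha == mu * sqrt_pn * xi ^+ j)
                        || (walsh f alpha == - (mu * sqrt_pn * xi ^+ j))].

Definition weakly_regular f : Prop :=
  bent f /\
  exists2 lambda : R[i], lambda \in [:: 1; -1; 'i%C; - 'i%C] &
    forall alpha, walsh f alpha = lambda * sqrt_pn * xi ^+ dual f alpha.

Definition non_weakly_regular f : Prop := bent f /\ ~ weakly_regular f.

Definition dual_bent f : Prop := bent f /\ bent (dual f).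

Definition Bplus f : {set 'rV['F_p]_n} :=
  [set alpha | walsh f alpha == mu * sqrt_pn * xi ^+ dual f alpha].

Definition Bminus f : {set 'rV['F_p]_n} :=
  [set alpha | walsh f alpha == - (mu * sqrt_pn * xi ^+ dual f alpha)].

Definition cset f (j : 'F_p) : {set 'rV['F_p]_n} :=
  [set x in Bplus (dual f) | f x == j].

Definition dset f (j : 'F_p) : {set 'rV['F_p]_n} :=
  [set x in Bminus (dual f) | f x == j].

Definition DBF f : Prop :=
  [/\ dual_bent f,
      f 0 = 0 &
      exists h : nat,
        [/\ (0 < h)%N, gcdn (h - 1) (p - 1) = 1%N &
            forall (a : 'F_p) (x : 'rV['F_p]_n),
              a != 0 -> f (a *: x) = a ^+ h * f x]].

Definition U14 f : {set {set 'rV['F_p]_n}} :=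
  [set [set 0]] :|: [set cset f j | j : 'F_p]
    :|: [set dset f 0 :\ 0] :|: [set dset f j | j in NSQ p].

Definition U15 f : {set {set 'rV['F_p]_n}} :=
  [set [set 0]] :|: [set cset f j | j : 'F_p]
    :|: [set dset f 0 :\ 0] :|: [set dset f j | j in SQ p].

Definition U16 f : {set {set 'rV['F_p]_n}} :=
  [set [set 0]] :|: [set cset f j | j : 'F_p]
    :|: [set orth (Bminus f) :\ 0] :|: [set dset f 0 :\: orth (Bminus f)]
    :|: [set dset f j | j : 'F_p & j != 0].

Definition U17 f : {set {set 'rV['F_p]_n}} :=
  [set [set 0]] :|: [set cset f j | j : 'F_p]
    :|: [set orth (Bplus f) :\ 0] :|: [set dset f 0 :\: orth (Bplus f)]
    :|: [set dset f j | j : 'F_p & j != 0].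

End BentFunctions.

(* Main.v *)
Require Import Defs.
From HB Require Import structures.
From mathcomp Require Import all_boot all_order all_algebra.
From mathcomp Require Import complex.
From mathcomp Require Import reals trigo.
From mathcomp Require Import finfield ring zify.

Set Implicit Arguments.
Unset Strict Implicit.
Unset Printing Implicit Defensive.

Import Order.TTheory GRing.Theory Num.Theory.
Local Open Scope ring_scope.

(* In Z[xi] the prime p is totally ramified, so an element of squared modulus
   p^n, with n odd, is a Gauss sum times a power of p times a unit of modulus 1,
   that is, times +-xi^k; this gives the dual g of f.  Put T = B_-(g), and
   S = B_-(f) if p = 1 mod 4, S = B_+(f) if p = 3 mod 4.  Fourier inversion and
   a parity argument give g^*(-x) = f(x) and show that the sums of
   xi^(f(x) - a.x) over T and over its complement are supported on S and on its
   complement, with values given by g; dually for g on S.  Hence the orthogonal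
   of S is contained in T and f vanishes on it, and symmetrically for g.  The
   level counts of f on T follow from the Gauss sum, whose sign is needed for
   r = (n+1)/2.  By homogeneity the Fourier transform of every block is constant
   on the blocks of the analogous partition built from g and S, which has as
   many blocks; such a pair of partitions forces an association scheme. *)

(** * Cyclotomic integers *)

(** No ring of integers is built: [Z[xi]] is handled through integer polynomials evaluated at
    [xi - 1]. The value fixes such a polynomial up to a multiple of an Eisenstein polynomial, which
    is a power of ['X] modulo p; hence its coefficients below degree p - 1 make sense modulo p and
    serve as digits. Galois conjugation is replaced by a comparison of level counts. The switch from
    B_- to B_+ has one cause. Put m = (p - 1)/2 and let G be p^((n-1)/2) times the Gauss sum; the
    conjugate of G is [(-1) ^+ m * G]. Fourier inversion exchanges G with its conjugate, and for p =
    3 mod 4 the resulting sign turns B_-(f) into B_+(f). The sign of the Gauss sum ties the constant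
    mu to G. The opposite sign would exchange squares and nonsquares among the indices j with d_j
    nonempty. Homogeneity is given for f only. The transforms are therefore computed in one
    direction, from the blocks of f to those of g, and the equality of the numbers of blocks
    replaces the other direction. *)

Section RootOfUnity.
Variables (C : numClosedFieldType) (p : nat) (z : C).
Hypotheses (p_prime : prime p) (zP : p.-primitive_root z).

Definition zchar (a : 'F_p) : C := z ^+ a.

Lemma zchar_nat (k : nat) : zchar k%:R = z ^+ k.
Proof. by rewrite /zchar val_Fp_nat // prim_expr_mod. Qed.

Lemma zchar0 : zchar 0 = 1. Proof. by rewrite /zchar expr0. Qed.

Lemma zcharD a b : zchar (a + b) = zchar a * zchar b.
Proof. by rewrite -[a]natr_Zp -[b]natr_Zp -natrD !zchar_nat exprD. Qed.

Lemma norm_root : `|z| = 1.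
Proof.
have : `|z| ^+ p == 1 by rewrite -normrX (prim_expr_order zP) normr1.
by rewrite pexpr_eq1 ?normr_ge0 ?(prime_gt0 p_prime) // => /eqP.
Qed.

Lemma root_conj : z^* * z = 1.
Proof. by rewrite mulrC -normCK norm_root expr1n. Qed.

Lemma norm_zchar a : `|zchar a| = 1.
Proof. by rewrite normrX norm_root expr1n. Qed.

Lemma zchar_neq0 a : zchar a != 0.
Proof. by rewrite -normr_gt0 norm_zchar. Qed.

Lemma zcharN a : zchar (- a) = (zchar a)^*.
Proof.
apply: (mulIf (zchar_neq0 a)); rewrite -zcharD addNr zchar0.
by rewrite mulrC -normCK norm_zchar expr1n.
Qed.

Lemma zchar_inj : injective zchar.
Proof.
move=> a b /eqP; rewrite (eq_prim_root_expr zP) => /eqP.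
rewrite !modn_small; first by move/ord_inj.
  by case: b => b /=; rewrite Fp_cast.
by case: a => a /=; rewrite Fp_cast.
Qed.

Lemma zchar_eq1 a : (zchar a == 1) = (a == 0).
Proof. by rewrite -zchar0 (inj_eq zchar_inj). Qed.

Lemma sum_zcharM (c : 'F_p) :
  \sum_a zchar (c * a) = if c == 0 then p%:R else 0.
Proof.
have [->|c0] := eqVneq c 0.
  under eq_bigr do rewrite mul0r zchar0.
  by rewrite sumr_const card_Fp.
set s := \sum_a _; have e1 : zchar c * s = s.
  rewrite mulr_sumr [RHS](reindex_inj (addrI 1)) /=.
  by apply: eq_bigr => a _; rewrite mulrDr mulr1 zcharD.
apply/eqP; move/eqP: e1; rewrite -subr_eq0 -{2}[s]mul1r -mulrBl mulf_eq0.
by rewrite subr_eq0 zchar_eq1 (negPf c0).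
Qed.

Lemma sum_zchar : \sum_a zchar a = 0.
Proof.
have := sum_zcharM 1; rewrite oner_eq0 => e0; rewrite -[RHS]e0.
by apply: eq_bigr => a _; rewrite mul1r.
Qed.

(* Polynomials are evaluated at [z - 1] rather than at [z] because this turns
   the cyclotomic polynomial into an Eisenstein polynomial. *)
Local Notation ev := (horner_morph (fun a : int => mulrC (z - 1) a%:~R)).

(** The p-th cyclotomic polynomial at ['X + 1], that is, ((X + 1)^p - 1)/X expanded. *)
Definition eis : {poly int} := \poly_(i < p) ('C(p, i.+1) : int).

Lemma size_eis : size eis = p.
Proof.
rewrite size_poly_eq //; last by rewrite prednK ?prime_gt0 // binn.
Qed.

Lemma eis_binom : eis * 'X = ('X + 1) ^+ p - 1.
Proof.
rewrite [_ + 1]addrC exprDn big_ord_recl bin0 expr0 mulr1 expr1n mulr1n.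
rewrite addrAC subrr add0r /eis poly_def mulr_suml.
apply: eq_bigr => i _; rewrite expr1n mul1r -scalerAl -exprSr.
by rewrite -scaler_nat /= natz.
Qed.

Lemma root_sub1_neq0 : z - 1 != 0.
Proof.
rewrite subr_eq0 -(expr1 z) -(prim_order_dvd zP) dvdn1.
by apply: contraTneq p_prime => ->.
Qed.

Lemma ev_eis : ev eis = 0.
Proof.
apply: (mulIf root_sub1_neq0); rewrite mul0r -[X in _ * X](horner_morphX
  (fun a : int => mulrC (z - 1) a%:~R)) -rmorphM eis_binom.
by rewrite rmorphB rmorphXn rmorphD rmorph1 /= horner_morphX subrK
  (prim_expr_order zP) subrr.
Qed.

Lemma eis_irr : irreducible_poly eis.
Proof.
have e0 : eis`_0 = p by rewrite coef_poly prime_gt0 // bin1.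
apply: (eisenstein_crit p_prime).
- by rewrite size_eis; apply: contraTneq p_prime => ->.
- rewrite lead_coefE size_eis coef_poly prednK ?prime_gt0 // leqnn binn.
  by rewrite dvdz1 /=; apply: contraTneq p_prime => ->.
- rewrite e0 /dvdz; change (~~ (p ^ 2 %| p)%N).
  by rewrite -{2}[p]expn1 dvdn_Pexp2l // prime_gt1.
- move=> i; rewrite size_eis => ilt; rewrite coef_poly.
  have -> : (i < p)%N by lia.
  change (p %| 'C(p, i.+1))%N; rewrite prime_dvd_bin //; lia.
Qed.

(** Over the rationals [eis] is irreducible and vanishes at [z - 1], so Bezout shows that any [q]
    vanishing there is a multiple of it. The size bound means degree at most p - 2, less than that
    of [eis]. *)
Lemma size_ev0 (q : {poly int}) : (size q < p)%N -> ev q = 0 -> q = 0.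
Proof.
move=> sq q0; apply/eqP; apply: contraT => qN0.
pose i2q := map_poly (intr : int -> rat).
have si (r : {poly int}) : size (i2q r) = size r.
  by rewrite size_map_inj_poly // ?rmorph0 //; apply: intr_inj.
have irr : irreducible_poly (i2q eis) by apply/irreducible_rat_int/eis_irr.
have evr r : (map_poly ratr (i2q r)).[z - 1] = ev r.
  rewrite /horner_morph -map_poly_comp; congr (_.[_]).
  by apply: eq_map_poly => a /=; rewrite ratr_int.
have [] := boolP (coprimep (i2q q) (i2q eis)).
  move=> /Bezout_eq1_coprimepP[[u v] /= /(congr1 (map_poly (ratr : rat -> C)))].
  move/(congr1 (horner^~ (z - 1))); rewrite rmorphD !rmorphM /= !hornerE !evr.
  by rewrite q0 ev_eis !mulr0 addr0 rmorph1 hornerE => /esym/eqP; rewrite oner_eq0.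
rewrite coprimep_sym (irreducible_poly_coprime _ irr) negbK => /dvdp_leq.
rewrite !si size_eis leqNgt sq -size_poly_eq0 si size_poly_eq0 => /(_ qN0) //.
Qed.

Lemma ev_zchar (a : 'F_p) : ev (('X + 1) ^+ a) = zchar a.
Proof. by rewrite rmorphXn rmorphD rmorph1 /= horner_morphX subrK. Qed.

End RootOfUnity.

Section CyclotomicIntegers.
Variables (C : numClosedFieldType) (p : nat) (z : C).
Hypotheses (p_prime : prime p) (zP : p.-primitive_root z).
Local Notation e := (@zchar C p z).
Local Notation ev := (horner_morph (fun a : int => mulrC (z - 1) a%:~R)).

Lemma sum_Fp (V : nmodType) (F : 'F_p -> V) :
  \sum_j F j = \sum_(i < p) F i%:R.
Proof.
rewrite -(big_mkord xpredT (fun i => F i%:R)).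
rewrite -(congr1 (index_iota 0) (Fp_cast p_prime)) big_mkord.
by apply: eq_bigr => j _; rewrite natr_Zp.
Qed.

(** Up to multiples, the only integral relation between the powers of [z] is that they sum to 0.
    Subtracting a multiple of it kills the coefficient at [- 1], which is the exponent p - 1, and
    the rest has degree too small for a nontrivial relation. *)
Lemma zchar_lin0 (a : 'F_p -> int) :
  \sum_j (a j)%:~R * e j = 0 -> forall i j, a i = a j.
Proof.
move=> a0; suff aN1 j : a j = a (- 1) by move=> i j; rewrite !aN1.
pose b j := a j - a (-1).
pose r : {poly int} := \poly_(i < p.-1) b i%:R.
have b1 : b p.-1%:R = 0.
  rewrite /b; suff -> : p.-1%:R = -1 :> 'F_p by rewrite subrr.
  by apply/eqP; rewrite -subr_eq0 opprK natr1 prednK ?prime_gt0 // pchar_Fp_0.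
have sz : (size r < p)%N.
  by rewrite (leq_ltn_trans (size_poly _ _)) // prednK // prime_gt0.
have s2 : size ('X + 1 : {poly int}) = 2 by rewrite size_XaddC.
have r0 : r = 0.
  suff : r \Po ('X + 1) = 0.
    by move/eqP; rewrite -size_poly_eq0 size_comp_poly2 // size_poly_eq0 => /eqP.
  apply: (size_ev0 p_prime zP); first by rewrite size_comp_poly2.
  rewrite /horner_morph map_comp_poly rmorphD rmorph1 /= map_polyX.
  rewrite horner_comp !hornerE subrK.
  have -> : (map_poly intr r).[z] = \sum_(i < p) (b i%:R)%:~R * e i%:R.
    have recr (F : nat -> C) : \sum_(i < p) F i = \sum_(i < p.-1) F i + F p.-1.
      by case: (p) (prime_gt0 p_prime) => // k _; rewrite big_ord_recr.
    rewrite (recr (fun i => (b i%:R)%:~R * e i%:R)).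
    rewrite b1 mul0r addr0 /r poly_def rmorph_sum /= horner_sum.
    apply: eq_bigr => i _; rewrite -mul_polyC rmorphM /= map_polyC map_polyXn.
    by rewrite !hornerE zchar_nat.
  rewrite -(sum_Fp (fun j => (b j)%:~R * e j)).
  under eq_bigr => k _ do rewrite /b rmorphB mulrBl.
  by rewrite sumrB a0 -mulr_sumr sum_zchar // mulr0 subr0.
have {r0} : r`_j = 0 by rewrite r0 coef0.
rewrite coef_poly natr_Zp; case: ltnP => [_ /eqP|hj _]; first by rewrite subr_eq0 => /eqP.
have jp : (j < p)%N by case: (j) => /= j'; rewrite Fp_cast.
rewrite -[j]natr_Zp; have -> : j = p.-1 :> nat by lia.
by apply/eqP; rewrite -subr_eq0; apply/eqP.
Qed.

Lemma sum_level (V : finType) (S : semiRingType) (D : {set V}) (u : V -> 'F_p) (F : 'F_p -> S) :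
  \sum_(x in D) F (u x) = \sum_j #|[set x in D | u x == j]|%:R * F j.
Proof.
rewrite (partition_big u xpredT) //=; apply: eq_bigr => j _.
under eq_bigr => x /andP[_ /eqP ->] do [].
rewrite sumr_const mulr_natl; congr (_ *+ _).
by apply: eq_card => x; rewrite !inE.
Qed.

Lemma level_diff (V W : finType) (D : {set V}) (E : {set W}) (u : V -> 'F_p)
    (v : W -> 'F_p) :
  \sum_(x in D) e (u x) = \sum_(y in E) e (v y) ->
  forall i j,
  #|[set x in D | u x == i]|%:Z - #|[set x in E | v x == i]|%:Z =
  #|[set x in D | u x == j]|%:Z - #|[set x in E | v x == j]|%:Z.
Proof.
rewrite !sum_level => /eqP; rewrite -subr_eq0 -sumrB => /eqP s0.
apply: zchar_lin0; rewrite -[RHS]s0; apply: eq_bigr => j _.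
by rewrite rmorphB /= mulrBl.
Qed.

(** This is the Galois action z -> z^c without the automorphism: by [level_diff] the hypothesis says
    that the level counts differ by a constant, and a constant contributes 0 after the exponents are
    multiplied by [c] as well. *)
Lemma zchar_gal (V W : finType) (D : {set V}) (E : {set W}) (u : V -> 'F_p)
    (v : W -> 'F_p) (c : 'F_p) : c != 0 ->
  \sum_(x in D) e (u x) = \sum_(y in E) e (v y) ->
  \sum_(x in D) e (c * u x) = \sum_(y in E) e (c * v y).
Proof.
move=> c0 /level_diff lv; apply/eqP; rewrite -subr_eq0.
rewrite !(sum_level _ _ (fun j => e (c * j))) -sumrB.
under eq_bigr => j _.
  rewrite -mulrBl; move: (congr1 (intr : int -> C) (lv j 0)).
  by rewrite [in X in X = _ -> _]rmorphB /= => ->; over.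
by rewrite -mulr_sumr sum_zcharM // (negPf c0) mulr0.
Qed.

Lemma ev_fold (q : {poly int}) :
  exists b : 'F_p -> int, ev q = \sum_j (b j)%:~R * e j.
Proof.
elim/poly_ind: q => [|q c [b bE]].
  by exists (fun=> 0); rewrite rmorph0 big1 // => j _; rewrite mul0r.
(* Multiplication by [z - 1] shifts the exponents by one and subtracts; the constant [c] goes to
   exponent 0. *)
exists (fun j => b (j - 1) - b j + (j == 0)%:R * c).
rewrite rmorphD rmorphM /= horner_morphX horner_morphC bE mulrBr mulr1 mulr_suml.
under [RHS]eq_bigr => j _ do rewrite rmorphD rmorphB mulrDl mulrBl /=.
rewrite big_split /= sumrB; congr (_ - _ + _).
  rewrite [RHS](reindex_inj (addIr 1)) /=; apply: eq_bigr => j _.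
  by rewrite addrK zcharD // (zchar_nat p_prime zP 1) mulrA.
rewrite (bigD1 0) //= big1 ?addr0 ?zchar0 ?mulr1 ?mul1r // => j /negPf ->.
by rewrite mul0r mul0r.
Qed.

Lemma ev_unfold (b : 'F_p -> int) :
  exists q : {poly int}, ev q = \sum_j (b j)%:~R * e j.
Proof.
exists (\sum_j (b j)%:P * ('X + 1) ^+ j); rewrite rmorph_sum /=.
by apply: eq_bigr => j _; rewrite rmorphM /= horner_morphC ev_zchar.
Qed.

(** The conjugate of [z - 1] is [z ^+ p.-1 - 1], the value of a polynomial [t] without constant
    term. Replacing ['X] by [t] keeps the constant coefficient, which modulo p is the residue class
    modulo [z - 1]. *)
Lemma ev_conj (q : {poly int}) : exists2 q' : {poly int}, q'`_0 = q`_0 & (ev q)^* = ev q'.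
Proof.
pose t : {poly int} := ('X + 1) ^+ p.-1 - 1.
have t0 : t`_0 = 0.
  rewrite -horner_coef0 !hornerE expr1n; exact: subrr.
have tE : ev t = (z - 1)^*.
  rewrite rmorphB rmorphXn rmorphD rmorph1 /= horner_morphX subrK rmorphB rmorph1.
  congr (_ - _); apply: (mulIf (_ : z != 0)).
    by rewrite -normr_gt0 (norm_root p_prime zP).
  by rewrite -exprSr prednK ?prime_gt0 // (prim_expr_order zP) (root_conj p_prime zP).
elim/poly_ind: q => [|q c [q' q'0 qE]].
  by exists 0; rewrite // !rmorph0.
exists (q' * t + c%:P).
  by rewrite !coefD coefMX coef0M t0 mulr0 coefC.
rewrite !rmorphD !rmorphM /= horner_morphX !horner_morphC qE.
rewrite [in RHS]tE; congr (_ + _); apply: rmorph_int.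
Qed.

(** The monic [eis] divides [q], and modulo p it is the power of ['X] of exponent p - 1. Applied to
    a difference, this shows that the low coefficients modulo p depend only on the value. *)
Lemma ev0_coef (q : {poly int}) i : ev q = 0 -> (i < p.-1)%N -> (p %| q`_i)%Z.
Proof.
move=> q0 ip; have emon : eis p \is monic.
  by rewrite monicE lead_coefE size_eis // coef_poly prednK ?prime_gt0 // leqnn binn.
have := Pdiv.RingMonic.rdivp_eq emon q; set r := Pdiv.Ring.rmodp _ _ => qE.
have r0 : r = 0.
  apply: (size_ev0 p_prime zP).
    by rewrite -[X in (_ < X)%N]size_eis // Pdiv.Ring.ltn_rmodp monic_neq0.
  by move: q0; rewrite qE rmorphD rmorphM /= ev_eis // mulr0 add0r.
rewrite qE r0 addr0 coefM; apply: rpred_sum => k _; apply: dvdz_mull.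
rewrite coef_poly; case: ifP => // kp.
by change (p %| 'C(p, (i - k).+1))%N; rewrite prime_dvd_bin //; lia.
Qed.

End CyclotomicIntegers.

(** * The valuation at z - 1 and cyclotomic integers of modulus 1 *)

Section UnitModulus.
Variables (C : numClosedFieldType) (p : nat) (z : C).
Hypotheses (p_prime : prime p) (zP : p.-primitive_root z).
Local Notation e := (@zchar C p z).
Local Notation ev := (horner_morph (fun a : int => mulrC (z - 1) a%:~R)).
Local Notation u := (z - 1).

Lemma ev_nat k : ev (k%:Z)%:P = k%:R.
Proof. by rewrite horner_morphC. Qed.

Lemma prime_ev_val1 : exists s : {poly int}, p%:R = u * ev s.
Proof.
have : eis p = eis p := erefl; have : (eis p)`_0 = p%:Z.
  by rewrite coef_poly prime_gt0 // bin1.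
move: (ev_eis p_prime zP); elim/poly_ind: {1 2}(eis p) => [|q c _].
  by rewrite coef0 => _ /esym/eqP; rewrite eqz_nat; case: p (prime_gt0 p_prime).
rewrite coefD coefMX coefC add0r /= => + cE _.
rewrite cE rmorphD rmorphM /= horner_morphX ev_nat => /eqP.
rewrite addrC addr_eq0 => /eqP ->; exists (- q).
by rewrite rmorphN /= mulrN mulrC.
Qed.

Lemma ev_val1 (q : {poly int}) :
  (p %| q`_0)%Z -> exists q', ev q = u * ev q'.
Proof.
elim/poly_ind: q => [|q c _]; first by exists 0; rewrite !rmorph0 mulr0.
rewrite coefD coefMX coefC add0r /= => /dvdzP[d ->].
have [s sE] := prime_ev_val1; exists (q + d%:P * s).
rewrite !rmorphD !rmorphM /= horner_morphX [RHS]mulrDr mulrC; congr (_ + _).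
by rewrite [X in _ * X = _]ev_nat sE mulrCA.
Qed.

Lemma exp_eis : exists2 q : {poly int}, q`_0 = 1 & u ^+ p.-1 = - p%:R * ev q.
Proof.
have p0 := prime_gt0 p_prime; have p1 := prime_gt1 p_prime.
pose q : {poly int} := \poly_(i < p.-1) ('C(p, i.+1) %/ p)%N%:Z.
exists q; first by rewrite coef_poly -subn1 subn_gt0 p1 bin1 divnn p0.
have : eis p = 'X^(p.-1) + (p%:Z)%:P * q.
  apply/polyP => i; rewrite coefD coefXn coefCM !coef_poly.
  case: (ltngtP i p.-1) => ip.
  - have -> : (i < p)%N by lia.
    rewrite add0r -PoszM mulnC divnK // prime_dvd_bin //; lia.
  - have -> : (i < p)%N = false by lia.
    by rewrite mulr0.
  - by rewrite ip prednK // leqnn binn mulr0 addr0.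
move/(congr1 ev); rewrite ev_eis // rmorphD rmorphM rmorphXn /= horner_morphX.
by rewrite ev_nat => /esym/eqP; rewrite addr_eq0 mulNr => /eqP.
Qed.

(** Inverting the factor [ev q] of [exp_eis] is avoided: writing it as 1 + u e1 gives p = - u^(p-1)
    - p u e1, so each power of [u] known to divide p can be raised by one, up to p - 1. *)
Lemma prime_ev_val : exists t : {poly int}, p%:R = u ^+ p.-1 * ev t.
Proof.
have [q q0 qE] := exp_eis; have [e1 e1E] : exists e1 : {poly int}, ev q = 1 + u * ev e1.
  have [|e1 e1E] := @ev_val1 (q - 1); first by rewrite coefB coef1 q0 subrr.
  by exists e1; rewrite -e1E rmorphB rmorph1 [1 + _]addrC subrK.
suff H k : (k <= p.-1)%N -> exists t : {poly int}, p%:R = u ^+ k * ev t by exact: H.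
elim: k => [_|k IH kp]; first by exists (p%:Z)%:P; rewrite expr0 mul1r ev_nat.
have [t tE] := IH (ltnW kp).
exists (- 'X^(p.-1 - k.+1) - t * e1).
rewrite rmorphB rmorphN rmorphM rmorphXn /= horner_morphX [RHS]mulrBr mulrN -exprD.
rewrite subnKC // qE e1E exprSr -[u ^+ k * u * _]mulrA [u * (ev t * _)]mulrCA [u ^+ k * _]mulrA -tE.
by rewrite mulNr opprK mulrDr mulr1 addrK.
Qed.

(* The residue field Z[z]/(z - 1) is the prime field, on which complex
   conjugation acts trivially; hence [y] and [y^*] have the same valuation. *)
Lemma half_val k (y t : {poly int}) :
  ev y * (ev y)^* = u ^+ (k * 2) * ev t -> exists y', ev y = u ^+ k * ev y'.
Proof.
elim: k y t => [|k IH] y t; first by exists y; rewrite mul1r.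
have [yc yc0 ycE] := ev_conj p_prime zP y => yE.
have : (p %| (y * yc - 'X^(k.+1 * 2) * t)`_0)%Z.
  apply: (ev0_coef p_prime zP); last by have := prime_gt1 p_prime; lia.
  by rewrite rmorphB rmorphM [in X in _ - X]rmorphM rmorphXn /= horner_morphX -yE ycE subrr.
rewrite coefB coef0M [(_ * t)`_0]coef0M coefXn mul0r subr0 yc0 => yy.
have /ev_val1[y2 y2E] : (p %| y`_0)%Z.
  move: yy; rewrite !dvdzE abszM Euclid_dvdM //; by case/orP.
have u0 : u != 0 := root_sub1_neq0 p_prime zP.
have uc : u^* * z = - u.
  by rewrite rmorphB rmorph1 mulrBl (root_conj p_prime zP) mul1r opprB.
(* Since the conjugate of [u] is - u/z, cancelling [u] from [y] and its conjugate from the conjugate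
   of [y] leaves the unit - z, the value of [- ('X + 1)]. *)
have [|y' y'E] := IH y2 (- ('X + 1) * t).
  apply: (mulfI (mulf_neq0 u0 u0)).
  have -> : u * u * (ev y2 * (ev y2)^*) = - z * (ev y * (ev y)^*).
    rewrite y2E rmorphM /=.
    have -> : - z * (u * ev y2 * (u^* * (ev y2)^*)) =
      - (u^* * z) * (u * ev y2 * (ev y2)^*) by ring.
    by rewrite uc; ring.
  rewrite yE rmorphM rmorphN rmorphD rmorph1 /= horner_morphX subrK.
  by rewrite mulSn exprD expr2; ring.
by exists y'; rewrite y2E y'E exprS mulrA.
Qed.

(** The squared modulus has the autocorrelations of [b] as coefficients. Since it equals 1,
    [zchar_lin0] makes them all equal once 1 is subtracted at index 0; their sum is the square of
    the sum of [b], and the one at index 0 is the sum of squares. *)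
Lemma autocorr (b : 'F_p -> int) :
  (\sum_j (b j)%:~R * e j) * (\sum_j (b j)%:~R * e j)^* = 1 ->
  (\sum_j b j) ^+ 2 - 1 = p%:Z * (\sum_j b j ^+ 2 - 1).
Proof.
move=> b1; pose c k := \sum_j b (k + j) * b j.
have cE : \sum_k (c k)%:~R * e k = 1.
  rewrite -[RHS]b1 rmorph_sum mulr_sumr.
  under [RHS]eq_bigr => j _ do rewrite mulr_suml (reindex_inj (addIr j)) /=.
  rewrite exchange_big /=; apply: eq_bigr => k _.
  rewrite rmorph_sum mulr_suml; apply: eq_bigr => j _.
  have -> : e k = e (k + j) * (e j)^* by rewrite -zcharN // -zcharD // addrK.
  by rewrite !rmorphM /= rmorph_int; ring.
have /(zchar_lin0 p_prime zP) c0 : \sum_k (c k - (k == 0)%:R)%:~R * e k = 0.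
  under eq_bigr => k _ do rewrite rmorphB mulrBl.
  rewrite sumrB cE [X in _ - X](bigD1 0) //= zchar0 mulr1 big1 ?addr0 ?subrr //.
  by move=> k /negPf ->; rewrite mul0r.
have <- : \sum_k c k = (\sum_j b j) ^+ 2.
  rewrite exchange_big expr2 mulr_sumr; apply: eq_bigr => j _ /=.
  by rewrite -mulr_suml; congr (_ * _); rewrite [RHS](reindex_inj (addIr j)).
have <- : c 0 = \sum_j b j ^+ 2 by apply: eq_bigr => j _; rewrite add0r.
have d1 : \sum_(k : 'F_p) (k == 0)%:R = 1%R :> int.
  by rewrite (bigD1 0) //= big1 ?addr0 // => k /negPf ->.
rewrite -[X in _ - X = _]d1 -sumrB; under eq_bigr => k _ do rewrite (c0 k 0).
by rewrite sumr_const card_Fp // eqxx -[LHS]mulr_natl [p%:R]natz.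
Qed.

(* By [autocorr] the sum of the coefficients is +-1 modulo [p]; subtracting a
   multiple of [\sum_j z^j = 0] makes it +-1, and then the squares of the
   coefficients add up to 1. *)
Lemma unit_modulus (y : {poly int}) : ev y * (ev y)^* = 1 ->
  exists s k, ev y = (-1) ^+ (s : bool) * e k.
Proof.
have [b bE] := ev_fold p_prime zP y; rewrite bE => b1.
have := autocorr b1; set S := \sum_j b j => SE.
have [d [t tE]] : exists d : bool, exists t, S = (-1) ^+ d + t * p%:Z.
  have : (p %| (S - 1) * (S + 1))%Z by rewrite -subr_sqr expr1n SE dvdz_mulr.
  rewrite !dvdzE abszM Euclid_dvdM // -!dvdzE => /orP[] /dvdzP[t tE].
    by exists false, t; rewrite -tE expr0 addrC subrK.
  by exists true, t; rewrite -tE expr1 addrC addrK.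
pose b' j := b j - t.
have bE' : \sum_j (b' j)%:~R * e j = \sum_j (b j)%:~R * e j.
  under eq_bigr => j _ do rewrite rmorphB mulrBl.
  by rewrite sumrB -mulr_sumr sum_zchar // mulr0 subr0.
have S' : \sum_j b' j = (-1) ^+ d.
  by rewrite sumrB sumr_const card_Fp // -/S tE -mulr_natr natz addrK.
have sq1 : \sum_j b' j ^+ 2 = 1.
  have := autocorr (b := b'); rewrite bE' => /(_ b1); rewrite S' sqrr_sign subrr.
  move/esym/eqP; rewrite mulf_eq0 subr_eq0 eqz_nat => /orP[|/eqP //].
  by rewrite (gtn_eqF (prime_gt0 p_prime)).
have [k bk] : exists k, b' k != 0.
  apply/existsP; apply: contra_eqT sq1 => /existsPn b0.
  by rewrite big1 // => j _; have := b0 j; rewrite negbK => /eqP ->.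
have k1 : (1 <= b' k ^+ 2) by rewrite -gtz0_ge1 exprn_even_gt0.
have r0 : \sum_(j | j != k) b' j ^+ 2 = 0.
  apply/eqP; rewrite eq_le sumr_ge0 ?andbT; last by move=> j _; apply: sqr_ge0.
  by move: sq1; rewrite (bigD1 k) //= => E; rewrite -(lerD2l (b' k ^+ 2)) E addr0.
have bj j : j != k -> b' j = 0.
  move=> jk; apply/eqP; rewrite -sqrf_eq0; apply/eqP.
  by apply: (psumr_eq0P _ r0) => // i _; apply: sqr_ge0.
exists d, k; rewrite -bE' (bigD1 k) //= big1 ?addr0; last first.
  by move=> j /bj ->; rewrite mul0r.
by rewrite -(rmorph_sign (intr : {rmorphism int -> C})) -S' (bigD1 k) //= big1 ?addr0.
Qed.

End UnitModulus.

(** * Gauss sums *)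

Section QuadraticCharacter.
Variables (p : nat).
Hypotheses (p_prime : prime p) (p_odd : odd p).
Local Notation m := p./2.

Lemma half_double : p = (m * 2).+1.
Proof. by rewrite -[LHS]odd_double_half p_odd add1n muln2. Qed.

Lemma half_gt0 : (0 < m)%N.
Proof. by have := half_double; have := prime_gt1 p_prime; lia. Qed.

(** Euler's criterion serves as definition because the sign of the Gauss sum is read modulo p, where
    the symbol is the power a^m; the link with [SQ] and [NSQ] is proved below. *)
Definition legendre (a : 'F_p) : int :=
  if a == 0 then 0 else if a ^+ m == 1 then 1 else -1.

Lemma Fp_expr a : a != 0 -> a ^+ (m * 2) = 1 :> 'F_p.
Proof.
move=> a0; have : a ^+ (m * 2).+1 = 1 * a.
  by rewrite -half_double mul1r -[RHS]expf_card card_Fp.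
by rewrite exprSr => /(mulIf a0).
Qed.

Lemma Fp_expr_half a : a != 0 -> a ^+ m = 1 \/ a ^+ m = -1 :> 'F_p.
Proof.
move/Fp_expr/eqP; rewrite exprM sqrf_eq1 => /orP[] /eqP; by [left | right].
Qed.

Lemma Fp_opp1_neq : (-1 != 1 :> 'F_p).
Proof.
rewrite -subr_eq0 -opprD oppr_eq0 -[1 + 1]/(2%:R) -(dvdn_pcharf (pchar_Fp p_prime)).
apply/negP => /dvdn_leq -/(_ isT); have := half_double; have := half_gt0; lia.
Qed.

Lemma legendre_exp a : (legendre a)%:~R = a ^+ m :> 'F_p.
Proof.
rewrite /legendre; have [->|a0] := eqVneq a 0; first by rewrite expr0n eqn0Ngt half_gt0.
by case: (Fp_expr_half a0) => ->; rewrite ?eqxx // (negPf Fp_opp1_neq).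
Qed.

Lemma legendre0 : legendre 0 = 0. Proof. by rewrite /legendre eqxx. Qed.

Lemma legendre1 : legendre 1 = 1.
Proof. by rewrite /legendre oner_eq0 expr1n eqxx. Qed.

Lemma legendreM a b : legendre (a * b) = legendre a * legendre b.
Proof.
rewrite /legendre mulf_eq0; have [->|a0] := eqVneq a 0; first by rewrite /= !mul0r.
have [->|b0] := eqVneq b 0; first by rewrite /= !mulr0.
rewrite exprMn; have N1 := negPf Fp_opp1_neq.
by case: (Fp_expr_half a0) => ->; case: (Fp_expr_half b0) => ->;
  rewrite ?(mulrNN, mulr1, mul1r) ?(eqxx, N1) ?(mulrNN, mulr1, mul1r).
Qed.

Lemma legendre_sqr a : a != 0 -> legendre a * legendre a = 1.
Proof. by rewrite /legendre => /negPf ->; case: ifP. Qed.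

Lemma legendre_opp1 : legendre (-1) = (-1) ^+ m.
Proof.
rewrite /legendre oppr_eq0 oner_eq0 -[in LHS]signr_odd -[RHS]signr_odd; case: odd; rewrite ?expr0 ?eqxx //.
by rewrite !expr1 (negPf Fp_opp1_neq).
Qed.

(* Squaring is two-to-one, so there are at least [m] nonzero squares, while
   ['X^m - 1] has at most [m] roots. *)
Lemma SQ_roots : SQ p = [set a : 'F_p | a ^+ m == 1] /\ #|SQ p| = m.
Proof.
have sub : SQ p \subset [set a : 'F_p | a ^+ m == 1].
  apply/subsetP => a; rewrite !inE => /andP[a0 /existsP[b /eqP aE]].
  rewrite aE -exprM mulnC Fp_expr // ; apply: contraNneq a0 => b0.
  by rewrite aE b0 expr0n.
have le1 : (#|[set a : 'F_p | a ^+ m == 1%R]| <= m)%N.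
  have sz : size ('X^m - 1 : {poly 'F_p}) = m.+1 by rewrite size_XnsubC // half_gt0.
  have n0 : ('X^m - 1 : {poly 'F_p}) != 0 by rewrite -size_poly_eq0 sz.
  have := @max_poly_roots _ ('X^m - 1 : {poly 'F_p}) (enum [set a : 'F_p | a ^+ m == 1]) n0.
  rewrite sz ltnS -cardE; apply; last exact: enum_uniq.
  by apply/allP => a; rewrite mem_enum inE /root !hornerE subr_eq0.
have le2 : (m <= #|SQ p|)%N.
  rewrite -(leq_pmul2r (isT : 0 < 2)%N).
  have -> : (m * 2 = #|[set b : 'F_p | b != 0%R]|)%N.
    have := cardC1 (0 : 'F_p); rewrite card_Fp // => c1.
    have -> : (m * 2 = p.-1)%N by have := half_double; lia.
    by rewrite -c1; apply: eq_card => b; rewrite !inE.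
  rewrite -sum1_card (partition_big (fun b : 'F_p => b ^+ 2) (mem (SQ p))) /=; last first.
    move=> b; rewrite !inE => b0; rewrite expf_neq0 //=.
    by apply/existsP; exists b.
  rewrite -sum_nat_const; apply: leq_sum => a; rewrite inE => /andP[_ /existsP[b0 /eqP ->]].
  rewrite sum1_card; apply: leq_trans (_ : #|[set b0; - b0]| <= _)%N.
    apply: subset_leq_card; apply/subsetP => b; rewrite !inE => /andP[_].
    by rewrite eqf_sqr.
  by rewrite cards2; case: (_ == _).
split; last by apply/eqP; rewrite eqn_leq le2 andbT (leq_trans (subset_leq_card sub)).
by apply/eqP; rewrite eqEcard sub (leq_trans le1 le2).
Qed.

Lemma SQ_legendre a : (a \in SQ p) = (legendre a == 1).
Proof.
rewrite /legendre; have [->|a0] := eqVneq a 0; first by rewrite inE eqxx.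
by have [-> _] := SQ_roots; rewrite inE; case: ifP.
Qed.

Lemma NSQ_legendre a : (a \in NSQ p) = (legendre a == -1).
Proof.
have := SQ_legendre a; rewrite !inE /legendre; have [->|a0] //= := eqVneq a 0.
by move=> ->; case: ifP.
Qed.

Lemma card_SQ : #|SQ p| = m. Proof. by have [] := SQ_roots. Qed.

Lemma card_NSQ : #|NSQ p| = m.
Proof.
have : (1 + (#|SQ p| + #|NSQ p|) = p)%N.
  have := cardC1 (0 : 'F_p); rewrite card_Fp // => c1.
  have <- : #|predC1 (0 : 'F_p)| = (#|SQ p| + #|NSQ p|)%N.
    rewrite -cardUI [X in (_ + X)%N]eq_card0 ?addn0.
      by apply: eq_card => a; rewrite !inE; case: (a == 0) => //=; case: [exists _, _].
    by move=> a; rewrite !inE; case: [exists _, _]; rewrite ?andbF ?andbT.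
  by rewrite c1; have := prime_gt0 p_prime; lia.
by rewrite card_SQ; have := half_double; lia.
Qed.

Lemma sum_legendre : \sum_a legendre a = 0.
Proof.
have E a : legendre a = (a \in SQ p)%:R - (a \in NSQ p)%:R.
  rewrite SQ_legendre NSQ_legendre /legendre; case: (a == 0) => //; by case: (_ == _).
under eq_bigr => a _ do rewrite E.
rewrite sumrB -!natr_sum -!big_mkcond.
by rewrite !sum1_card card_SQ card_NSQ subrr.
Qed.

End QuadraticCharacter.

Section GaussSum.
Variables (C : numClosedFieldType) (p : nat) (z : C).
Hypotheses (p_prime : prime p) (p_odd : odd p) (zP : p.-primitive_root z).
Local Notation e := (@zchar C p z).
Local Notation ev := (horner_morph (fun a : int => mulrC (z - 1) a%:~R)).
Local Notation m := p./2.

Definition gauss : C := \sum_a (legendre a)%:~R * e a.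

Lemma gauss_conj : gauss^* = (-1) ^+ m * gauss.
Proof.
rewrite rmorph_sum mulr_sumr [RHS](reindex_inj oppr_inj) /=; apply: eq_bigr => a _.
have -> : legendre (- a) = (-1) ^+ m * legendre a by rewrite -[- a]mulN1r legendreM // legendre_opp1.
rewrite rmorphM /= rmorph_int -zcharN // rmorphM /= rmorph_sign.
by rewrite !mulrA -expr2 sqrr_sign mul1r.
Qed.

Lemma gauss_norm : gauss * gauss^* = p%:R.
Proof.
rewrite {2}/gauss rmorph_sum mulr_sumr /=.
(* The substitution a = t b separates the variables. Summing over nonzero b then gives p - 1 at t =
   1 and - 1 elsewhere. *)
have tE b : gauss * ((legendre b)%:~R * e b)^* =
    \sum_t (legendre t)%:~R * (if b != 0 then e ((t - 1) * b) else 0).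
  have [->|b0] := eqVneq b 0.
    rewrite legendre0 mul0r rmorph0 mulr0 big1 // => t _; exact: mulr0.
  rewrite /gauss (reindex_inj (mulIf b0)) mulr_suml; apply: eq_bigr => t _ /=.
  rewrite mulrBl mul1r zcharD // zcharN // legendreM // !rmorphM /= rmorph_int.
  have : (legendre b)%:~R * (legendre b)%:~R = 1 :> C by rewrite -rmorphM legendre_sqr.
  move: (legendre b)%:~R (legendre t)%:~R (e (t * b)) ((e b)^*) => x y v w xx.
  by transitivity (x * x * (y * (v * w))); [ring | rewrite xx mul1r].
under eq_bigr => b _ do rewrite tE; rewrite exchange_big /=.
have sE t : \sum_b (legendre t)%:~R * (if b != 0 then e ((t - 1) * b) else 0) =
    (t == 1)%:R * p%:R - (legendre t)%:~R :> C.
  rewrite -mulr_sumr -big_mkcond /=.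
  have := sum_zcharM p_prime zP (t - 1); rewrite (bigD1 0) //= mulr0 zchar0 => /(canRL (addKr 1)) ->.
  rewrite subr_eq0 mulrDr mulrN1 addrC; congr (_ - _).
  by have [->|_] := eqVneq t 1; rewrite ?legendre1 // ?mulr0 ?mul0r.
under eq_bigr => t _ do rewrite sE.
rewrite sumrB -[X in _ - X](rmorph_sum (intr : {rmorphism int -> C})) sum_legendre // subr0.
by rewrite (bigD1 1) //= ?eqxx mul1r big1 ?addr0 // => t /negPf ->; rewrite mul0r.
Qed.

Lemma gauss_sqr : gauss ^+ 2 = (-1) ^+ m * p%:R.
Proof.
by rewrite -gauss_norm gauss_conj mulrCA signrMK expr2.
Qed.

(** The classical product of w^k - w^(-k) for k = 1, ..., m, where w = z^(m+1) is the square root of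
    [z] among its powers; m is - (m + 1) modulo p. *)
Definition half_prod : C :=
  \prod_(k < m) (z ^+ (k.+1 * m.+1) - z ^+ (k.+1 * m)).

Lemma half_factor_conj k :
  (z ^+ (k * m.+1) - z ^+ (k * m))^* = - (z ^+ (k * m.+1) - z ^+ (k * m)).
Proof.
have zz : z ^+ (k * m.+1) * z ^+ (k * m) = 1.
  rewrite -exprD -mulnDr; have -> : (m.+1 + m = p)%N.
    by rewrite {3}(half_double p_odd); lia.
  by rewrite mulnC exprM (prim_expr_order zP) expr1n.
have cE i j : z ^+ i * z ^+ j = 1 -> (z ^+ i)^* = z ^+ j.
  move=> ij; apply: (mulfI (_ : z ^+ i != 0)).
    by rewrite -normr_gt0 normrX (norm_root p_prime zP) expr1n.
  by rewrite ij -normCK normrX (norm_root p_prime zP) !expr1n.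
by rewrite rmorphB /= (cE _ _ zz) (cE _ _ (etrans (mulrC _ _) zz)) opprB.
Qed.

Lemma prod_one_sub : \prod_(1 <= i < p) (1 - z ^+ i) = p%:R.
Proof.
have p0 := prime_gt0 p_prime.
have E : \prod_(1 <= i < p) ('X - (z ^+ i)%:P) = \sum_(i < p) 'X^i :> {poly C}.
  have X1 : ('X - 1 : {poly C}) != 0 by rewrite polyXsubC_eq0.
  apply: (mulfI X1); rewrite -subrX1 -(factor_Xn_sub_1 zP).
  by rewrite [RHS]big_ltn // expr0.
move/(congr1 (horner^~ 1)): E; rewrite horner_prod horner_sum.
under eq_bigr => i _ do rewrite !hornerE.
move=> ->; under eq_bigr => i _ do rewrite hornerXn expr1n.
by rewrite sumr_const card_ord.
Qed.

(** In [prod_one_sub] the factors of indices k and p - k multiply to the squared modulus of the k-th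
    factor of [half_prod]. *)
Lemma half_prod_norm : half_prod * half_prod^* = p%:R.
Proof.
rewrite -prod_one_sub rmorph_prod -big_split /=.
have pE : p = (m + m).+1 by have := half_double p_odd; lia.
rewrite (congr1 (index_iota 1) pE) big_add1 /= (big_cat_nat (leq0n m) (leq_addr m m)) /=.
rewrite [X in _ = _ * X](_ : _ = \prod_(0 <= k < m) (1 - z ^+ (p - k.+1))); last first.
  rewrite -{1}[m]add0n big_addn addnK big_nat_rev /=; apply: eq_big_nat => k km.
  by congr (1 - z ^+ _); lia.
rewrite -big_split /= big_mkord; apply: eq_bigr => k _.
have kp : (k.+1 < p)%N by have := ltn_ord k; lia.
have zz : z ^+ k.+1 * z ^+ (p - k.+1) = 1.
  by rewrite -exprD subnKC ?(prim_expr_order zP) // ltnW.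
have zkp : z ^+ (k.+1 * p) = 1 by rewrite mulnC exprM (prim_expr_order zP) expr1n.
have a2 : z ^+ (k.+1 * m.+1) * z ^+ (k.+1 * m.+1) = z ^+ k.+1.
  rewrite -exprD -mulnDr; have -> : (m.+1 + m.+1 = p + 1)%N by lia.
  by rewrite mulnDr muln1 exprD zkp mul1r.
have b2 : z ^+ (k.+1 * m) * z ^+ (k.+1 * m) = z ^+ (p - k.+1).
  apply: (mulfI (_ : z ^+ k.+1 != 0)).
    by rewrite -normr_gt0 normrX (norm_root p_prime zP) expr1n.
  rewrite zz -exprD -mulnDr -exprD.
  have -> : (k.+1 + k.+1 * (m + m) = k.+1 * p)%N by rewrite -mulnS -pE.
  by [].
have ab : z ^+ (k.+1 * m.+1) * z ^+ (k.+1 * m) = 1.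
  by rewrite -exprD -mulnDr; have -> : (m.+1 + m = p)%N by lia.
rewrite half_factor_conj.
move: (z ^+ (k.+1 * m.+1)) (z ^+ (k.+1 * m)) (z ^+ k.+1) (z ^+ (p - k.+1)) zz a2 b2 ab.
move=> A B u v zz a2 b2 ab.
have -> : (A - B) * - (A - B) = - (A * A) - B * B + A * B + A * B by ring.
by rewrite a2 b2 ab mulrBl mul1r mulrBr mulr1 zz; ring.
Qed.

Lemma half_prod_conj : half_prod^* = (-1) ^+ m * half_prod.
Proof.
rewrite rmorph_prod /= -[X in (-1) ^+ X]card_ord -prodr_const -big_split /=.
by apply: eq_bigr => k _; rewrite half_factor_conj mulN1r.
Qed.

Lemma half_prod_sqr : half_prod ^+ 2 = (-1) ^+ m * p%:R.
Proof.
by rewrite -half_prod_norm half_prod_conj mulrCA signrMK expr2.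
Qed.

End GaussSum.

(** * The sign of the Gauss sum relative to the product of sines *)

Section GaussSign.
Variables (C : numClosedFieldType) (p : nat) (z : C).
Hypotheses (p_prime : prime p) (p_odd : odd p) (zP : p.-primitive_root z).
Local Notation e := (@zchar C p z).
Local Notation ev := (horner_morph (fun a : int => mulrC (z - 1) a%:~R)).
Local Notation m := p./2.

Definition gauss_poly : {poly int} := \sum_(a : 'F_p) (legendre a)%:P * ('X + 1) ^+ a.

Definition half_poly : {poly int} :=
  \prod_(k < m) (('X + 1) ^+ (k.+1 * m.+1) - ('X + 1) ^+ (k.+1 * m)).

Lemma ev_gauss_poly : ev gauss_poly = gauss p z.
Proof.
rewrite rmorph_sum /=; apply: eq_bigr => a _.
by rewrite rmorphM /= horner_morphC ev_zchar.
Qed.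

Lemma ev_half_poly : ev half_poly = half_prod p z.
Proof.
rewrite rmorph_prod /=; apply: eq_bigr => a _.
by rewrite rmorphB !rmorphXn rmorphD rmorph1 /= horner_morphX subrK.
Qed.

(** Each of the m factors is ['X] times a polynomial whose value at 0 is k, with k running from 1 to
    m. *)
Lemma coef_half_poly : half_poly`_m = m`!%:Z.
Proof.
pose B k : {poly int} := ('X + 1) ^+ (k * m) * \sum_(i < k) ('X + 1) ^+ i.
have -> : half_poly = 'X^m * \prod_(k < m) B k.+1.
  rewrite /half_poly -[X in 'X^X]card_ord -prodr_const -big_split /=.
  apply: eq_bigr => k _; rewrite /B mulrCA -[X in X * \sum_(i < _) _](addrK 1 'X).
  by rewrite -subrX1 mulrBr mulr1 -exprD mulnS addnC.
rewrite coefXnM ltnn subnn -horner_coef0 horner_prod.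
rewrite fact_prod -natz natr_prod big_add1 big_mkord; apply: eq_bigr => k _.
rewrite /B hornerM horner_sum !hornerE expr1n mul1r.
under eq_bigr => i _ do rewrite !hornerE expr1n.
by rewrite sumr_const card_ord.
Qed.

(* The operator [(X + 1) d/dX] multiplies [('X + 1)^a] by [a]; starting from
   [\sum_a ('X + 1)^a = 'X^(p - 1)], its [m]-th power yields the
   reduction of [gauss_poly] by Euler's criterion. *)
Lemma power_sum_poly i : (i < p)%N ->
  exists2 A : {poly 'F_p}, A`_0 = (-1) ^+ i * i`!%:R &
    \sum_(a : 'F_p) (a ^+ i) *: ('X + 1) ^+ a = 'X^(p.-1 - i) * A.
Proof.
elim: i => [|i IH] ip.
  exists 1; first by rewrite coef1 mulr1.
  rewrite subn0 mulr1; under eq_bigr => a _ do rewrite expr0 scale1r.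
  rewrite (sum_Fp p_prime (fun a : 'F_p => ('X + 1 : {poly 'F_p}) ^+ a)).
  under eq_bigr => k _ do rewrite val_Fp_nat // modn_small //.
  apply: (mulfI (negbT (polyX_eq0 _))).
  rewrite -[X in X * \sum_(i < _) _](addrK 1 'X) -subrX1 -exprS prednK ?prime_gt0 //.
  have ch : p \in [pchar {poly 'F_p}] by rewrite pchar_poly pchar_Fp.
  rewrite exprDn_pchar; last by apply/pnatP; [exact: prime_gt0|];
    move=> q qp; rewrite dvdn_prime2 // => /eqP ->.
  by rewrite expr1n addrK.
have [A A0 AE] := IH (ltnW ip).
set n := (p.-1 - i)%N in AE; have n1 : n = (p.-1 - i.+1).+1 by rewrite /n; lia.
exists (('X + 1) * (A *+ n + 'X * A^`())).
  rewrite coef0M !coefD coefX coef1 coefMn coef0M coefX mul0r addr0 A0 /= add0r mul1r.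
  rewrite -[LHS]mulr_natr factS natrM exprS.
  have -> : n%:R = - i.+1%:R :> 'F_p.
    apply/eqP; rewrite -addr_eq0 -natrD; have -> : (n + i.+1 = p)%N by rewrite /n; lia.
    by rewrite pchar_Fp_0.
  ring.
have -> : \sum_(a : 'F_p) (a ^+ i.+1) *: ('X + 1 : {poly 'F_p}) ^+ a =
    ('X + 1) * (\sum_(a : 'F_p) (a ^+ i) *: ('X + 1) ^+ a)^`().
  rewrite raddf_sum mulr_sumr; apply: eq_bigr => a _ /=.
  rewrite derivZ deriv_exp derivD derivX derivC addr0 mul1r -scalerAr exprSr -scalerA.
  congr (_ *: _); rewrite mulrnAr -exprS -{1}[a]natr_Zp scaler_nat.
  by case: (nat_of_ord a) => // k; rewrite ?mulr0n.
rewrite AE derivM derivXn n1 /= -n1 mulrCA; congr (_ * _).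
by rewrite n1 exprSr mulrDr mulrnAr mulrnAl mulrA.
Qed.

(** The squares agree, so only a sign is unknown. It is read modulo p from the coefficients of
    degree m of the two polynomial lifts, which [ev0_coef] makes comparable as m < p - 1: they are
    (-1)^m m! and m!, and m! is prime to p. *)
Lemma gauss_half_prod : gauss p z = (-1) ^+ m * half_prod p z.
Proof.
have m0 := half_gt0 p_prime p_odd; have pE := half_double p_odd.
have [d dE] : exists d : bool, gauss p z = (-1) ^+ d * half_prod p z.
  have /eqP := etrans (gauss_sqr p_prime p_odd zP) (esym (half_prod_sqr p_prime p_odd zP)).
  rewrite eqf_sqr => /orP[] /eqP ->; first by exists false; rewrite expr0 mul1r.
  by exists true; rewrite expr1 mulN1r.
have : (p %| (gauss_poly - (-1) ^+ d * half_poly)`_m)%Z.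
  apply: (ev0_coef p_prime zP); last by lia.
  rewrite rmorphB rmorphM rmorph_sign /= ev_half_poly ev_gauss_poly dE subrr //.
rewrite (dvdz_pcharf (pchar_Fp p_prime)) coefB -signr_odd.
have -> : ((-1) ^+ odd d * half_poly)`_m = (-1) ^+ odd d * m`!%:Z.
  by case: odd; rewrite ?expr0 ?expr1 ?mul1r ?mulN1r ?coefN coef_half_poly.
have [|A A0 AE] := @power_sum_poly m; first lia.
have gE : (gauss_poly`_m)%:~R = A`_0 :> 'F_p.
  have -> : A`_0 = ('X^(p.-1 - m) * A)`_m.
    by have -> : (p.-1 - m = m)%N by [lia]; rewrite coefXnM ltnn subnn.
  rewrite -AE -coef_map /=; congr (_`_m); rewrite rmorph_sum /=.
  by under eq_bigr => a _ do rewrite rmorphM rmorphXn rmorphD rmorph1 /= map_polyC map_polyX /= legendre_exp // mul_polyC.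
rewrite rmorphB rmorphM rmorph_sign /= gE A0 -mulrBl mulf_eq0.
have -> : (m`!%:R == 0 :> 'F_p) = false.
  rewrite -(dvdn_pcharf (pchar_Fp p_prime)).
  have : (m < p)%N by lia.
  elim: (m) => [|k IH] kp; first by rewrite dvdn1 (gtn_eqF (prime_gt1 p_prime)).
  by rewrite factS Euclid_dvdM // (IH (ltnW kp)) orbF gtnNdvd.
rewrite orbF -[_ ^+ m]signr_odd => /eqP sE; rewrite dE; congr (_ * _).
rewrite -signr_odd -[RHS]signr_odd; congr (_ ^+ _).
have N1 := negPf (Fp_opp1_neq p_prime p_odd).
move: sE => /eqP; rewrite subr_eq0; case: (odd m); case: (odd d) => //.
  by rewrite N1.
by rewrite eq_sym N1.
Qed.

End GaussSign.

(** * Cyclotomic integers of squared modulus p^n *)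

Section BentValues.
Variables (C : numClosedFieldType) (p n : nat) (z : C).
Hypotheses (p_prime : prime p) (p_odd : odd p) (n_odd : odd n).
Hypothesis zP : p.-primitive_root z.
Local Notation e := (@zchar C p z).
Local Notation ev := (horner_morph (fun a : int => mulrC (z - 1) a%:~R)).
Local Notation m := p./2.

(** Multiplying [y] by the Gauss sum makes the exponent n + 1 of p in the squared modulus even. By
    [half_val] the product is then divisible by p^N with N = (n + 1)/2, and the quotient has modulus
    1, so [unit_modulus] applies. *)
Lemma ev_modulus (y : {poly int}) : ev y * (ev y)^* = p%:R ^+ n ->
  exists (s : bool) k, ev y = (-1) ^+ s * (p%:R ^+ n./2 * gauss p z) * e k.
Proof.
move=> yE; have pE := half_double p_odd; have nE := half_double n_odd.
have p0 : p%:R != 0 :> C by rewrite pnatr_eq0 -lt0n prime_gt0.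
have g0 : (gauss p z)^* != 0.
  have := gauss_norm p_prime p_odd zP; apply: contra_eqN => /eqP ->.
  by rewrite mulr0 eq_sym.
set N := n./2.+1; have nN : n.+1 = (N * 2)%N by rewrite /N; lia.
have [t tE] := prime_ev_val p_prime zP.
have [q q0 qE] := exp_eis p_prime zP.
have [|y2 y2E] := @half_val _ _ _ p_prime zP (m * n.+1) (y * gauss_poly p) (t ^+ n.+1).
  rewrite rmorphM /= ev_gauss_poly rmorphM /= mulrACA yE (gauss_norm p_prime p_odd zP).
  rewrite -exprSr tE exprMn -exprM rmorphXn; congr (_ ^+ _ * _).
  by have -> : p.-1 = (m * 2)%N by [lia]; rewrite mulnAC.
have wE : ev y * gauss p z = p%:R ^+ N * ev ((- q) ^+ N * y2).
  move: y2E; rewrite rmorphM /= ev_gauss_poly => ->; rewrite nN mulnA mulnAC exprM.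
  have -> : (m * 2 = p.-1)%N by lia.
  by rewrite qE mulNr -mulrN exprMn rmorphM rmorphXn rmorphN /= mulrA.
have [|s [k kE]] := unit_modulus p_prime zP (y := (- q) ^+ N * y2).
  have E : (ev y * gauss p z) * (ev y * gauss p z)^* = p%:R ^+ (N * 2).
    by rewrite [(_ * _)^*]rmorphM /= mulrACA yE gauss_norm // -exprSr nN.
  apply: (mulfI (expf_neq0 (N * 2) p0)); rewrite mulr1 -[RHS]E wE.
  by rewrite muln2 -addnn exprD [(_ * _)^*]rmorphM /= rmorphXn /= rmorph_nat mulrACA.
have gc := gauss_conj p_prime p_odd zP.
have [d dE] : exists d : bool, (gauss p z)^* = (-1) ^+ d * gauss p z.
  by exists (odd m); rewrite gc signr_odd.
(* Dividing by the Gauss sum amounts to multiplying by its conjugate over p, which contributes the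
   sign [d]. *)
exists (s (+) d), k; apply: (mulIf p0).
rewrite -{1}(gauss_norm p_prime p_odd zP) mulrA wE kE dE signr_addb /N exprS.
ring.
Qed.

End BentValues.

(** * The Gauss sum at the standard complex root of unity *)

Section ExpCircle.
Variables (R : realType).

Definition expi (t : R) : R[i] := (cos t +i* sin t)%C.

Lemma expiD s t : expi (s + t) = expi s * expi t.
Proof.
by rewrite /expi cosD sinD; apply/eqP; rewrite eq_complex /= addrC [X in _ && (_ == X)]addrC !eqxx.
Qed.

Lemma expi0 : expi 0 = 1.
Proof. by rewrite /expi cos0 sin0. Qed.

Lemma expiMn t k : expi (t *+ k) = expi t ^+ k.
Proof. by elim: k => [|k IH]; rewrite ?expi0 ?expr0 // mulrS expiD IH exprS. Qed.

Lemma expi_pi : expi pi = -1.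
Proof. by rewrite /expi cospi sinpi; apply/eqP; rewrite eq_complex /= oppr0 !eqxx. Qed.

Lemma expi_subN t : expi t - expi (- t) = (2 * sin t)%:C%C * 'i%C.
Proof.
rewrite /expi cosN sinN; apply/eqP; rewrite eq_complex /=; apply/andP; split; apply/eqP; ring.
Qed.

End ExpCircle.

Section RealGauss.
Variables (R : realType) (p : nat).
Hypotheses (p_prime : prime p) (p_odd : odd p).
Local Notation m := p./2.
Local Notation z := (xi R p).
Local Notation t := (pi / p%:R : R).

Lemma natr_prime_neq0 : p%:R != 0 :> R.
Proof. by rewrite pnatr_eq0 -lt0n prime_gt0. Qed.

Lemma xiE : z = expi (t *+ 2).
Proof. by rewrite /xi /expi -mulrnAl. Qed.

Lemma xi_expr k : z ^+ k = expi (t *+ (2 * k)).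
Proof. by rewrite xiE -expiMn mulrnA. Qed.

Lemma sin_frac_gt0 k : (0 < k < p)%N -> 0 < sin (t *+ k).
Proof.
move=> /andP[k0 kp]; have p0 : 0 < p%:R :> R by rewrite ltr0n prime_gt0.
apply: sin_gt0_pi; rewrite -[t *+ k]mulr_natr mulrAC; apply/andP; split.
  by apply: divr_gt0 => //; apply: mulr_gt0; rewrite ?pi_gt0 ?ltr0n.
by rewrite ltr_pdivrMr // ltr_pM2l ?pi_gt0 // ltr_nat.
Qed.

Lemma angleMp : t *+ p = pi.
Proof. by rewrite -[LHS]mulr_natr divfK // natr_prime_neq0. Qed.

Lemma xi_prim : p.-primitive_root z.
Proof.
have zp : z ^+ p = 1 by rewrite xi_expr mulnC mulrnA angleMp expiMn expi_pi expr2 mulrNN mulr1.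
have [k kP kd] := prim_order_exists (prime_gt0 p_prime) zp.
have [_ /(_ k kd) /orP[/eqP k1|/eqP kp]] := primeP p_prime; last by rewrite kp in kP.
move: kP; rewrite k1 => /prim_expr_order; rewrite expr1 xiE => z1.
have p1 := prime_gt1 p_prime; have := @sin_frac_gt0 1; rewrite p1 => /(_ isT).
have := expi_subN t; have -> : expi t = expi (- t).
  have := expiD (- t) (t *+ 2); rewrite z1 mulr1 => <-; congr expi; ring.
rewrite subrr => /eqP; rewrite eq_sym mulf_eq0 => /orP[].
  by rewrite (inj_eq (@complexI _)) mulf_eq0 pnatr_eq0 /= => /eqP ->; rewrite ltxx.
by rewrite eq_complex /= oner_eq0 andbF.
Qed.

(** As 2(m + 1) = p + 1 and 2m = p - 1, the two angles are k pi + k pi/p and k pi - k pi/p. *)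
Lemma half_factor k : z ^+ (k * m.+1) - z ^+ (k * m) =
  (-1) ^+ k * ((2 * sin (t *+ k))%:C%C * 'i%C).
Proof.
have pE := half_double p_odd.
have piE : pi *+ k = t *+ (p * k) :> R by rewrite mulrnA angleMp.
have aE : t *+ (2 * (k * m.+1)) = pi *+ k + t *+ k.
  by rewrite piE -mulrnDr; congr (_ *+ _); nia.
have bE : t *+ (2 * (k * m)) = pi *+ k - t *+ k.
  by apply: (addIr (t *+ k)); rewrite subrK piE -mulrnDr; congr (_ *+ _); nia.
by rewrite !xi_expr aE bE !expiD (expiMn pi) expi_pi -mulrBr -expi_subN.
Qed.

Definition gauss_phase : R[i] := if p == 1 %[mod 4] then 1 else 'i%C.

(** The sines in the product formula are positive, so the remaining factors give the phase; the
    modulus comes from [gauss_norm], with no evaluation of the sine product. *)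
Lemma gauss_value : gauss p z = gauss_phase * (Num.sqrt (p%:R : R))%:C%C.
Proof.
have pE := half_double p_odd.
pose rho : R := \prod_(k < m) (2 * sin (t *+ k.+1)).
have rho0 : 0 < rho.
  apply: prodr_gt0 => k _; rewrite mulr_gt0 ?ltr0n //; apply: sin_frac_gt0.
  by have := ltn_ord k; lia.
(* The sign [(-1) ^+ m] of [gauss_half_prod] turns each [(-1) ^+ k.+1] of [half_factor] into
   [(-1) ^+ k]. The partial products then alternate between 1 and i. *)
have iE : \prod_(k < m) ((-1) ^+ k * 'i%C) = gauss_phase.
  have H j : \prod_(k < j) ((-1) ^+ k * 'i%C) = (if odd j then 'i%C else 1) :> R[i].
    elim: j => [|j IH]; first by rewrite big_ord0.
    rewrite big_ord_recr IH /= -signr_odd; case: (odd j) => /=.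
      by rewrite expr1 mulrCA mulN1r -expr2 sqr_i opprK.
    by rewrite expr0 !mul1r.
  rewrite H /gauss_phase; have -> : (p == 1 %[mod 4]) = ~~ odd m by lia.
  by case: odd.
have gE : gauss p z = gauss_phase * rho%:C%C.
  rewrite (gauss_half_prod p_prime p_odd xi_prim) -iE /rho rmorph_prod.
  rewrite -[X in (-1) ^+ X]card_ord -prodr_const -!big_split /=; apply: eq_bigr => k _.
  by rewrite half_factor exprS; ring.
suff rE : rho = Num.sqrt p%:R by rewrite gE rE.
apply/eqP; rewrite -(eqrXn2 (n := 2)) ?sqrtr_ge0 ?(ltW rho0) // sqr_sqrtr ?ler0n //.
have := gauss_norm p_prime p_odd xi_prim; rewrite gE -normCK normrM.
have -> : `|gauss_phase| = 1.
  rewrite /gauss_phase; case: ifP => _; first exact: normr1.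
  by rewrite normc_def /= expr0n /= add0r expr1n sqrtr1.
rewrite mul1r ger0_norm ?lecR ?(ltW rho0) // -rmorphXn /= => E.
by apply/eqP/(@complexI R); rewrite E rmorph_nat.
Qed.

End RealGauss.

(** * Fourier transform and translation schemes *)

Section Dot.
Variables (F : finFieldType) (n : nat).
Implicit Types (x y : 'rV[F]_n) (B : {set 'rV[F]_n}).

Lemma dotC x y : dot x y = dot y x.
Proof. by apply: eq_bigr => i _; rewrite mulrC. Qed.

Lemma dotDr x y y' : dot x (y + y') = dot x y + dot x y'.
Proof. by rewrite -big_split; apply: eq_bigr => i _; rewrite mxE mulrDr. Qed.

Lemma dotZr a x y : dot x (a *: y) = a * dot x y.
Proof. by rewrite mulr_sumr; apply: eq_bigr => i _; rewrite mxE mulrCA. Qed.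

Lemma dotNr x y : dot x (- y) = - dot x y.
Proof. by rewrite -scaleN1r dotZr mulN1r. Qed.

Lemma dot0r x : dot x 0 = 0.
Proof. by rewrite -(scale0r 0) dotZr mul0r. Qed.

Lemma dotBr x y y' : dot x (y - y') = dot x y - dot x y'.
Proof. by rewrite dotDr dotNr. Qed.

Lemma dotDl x x' y : dot (x + x') y = dot x y + dot x' y.
Proof. by rewrite dotC dotDr !(dotC y). Qed.

Lemma dotNl x y : dot (- x) y = - dot x y.
Proof. by rewrite dotC dotNr dotC. Qed.

Lemma dot0l y : dot 0 y = 0.
Proof. by rewrite dotC dot0r. Qed.

Lemma dot_nondeg x : (forall y, dot x y = 0) -> x = 0.
Proof.
move=> x0; apply/rowP => i; rewrite mxE -(x0 (delta_mx 0 i)) /dot (bigD1 i) //=.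
rewrite mxE !eqxx mulr1 big1 ?addr0 // => j /negPf ji.
by rewrite mxE ji mulr0.
Qed.

Definition subgroup B := 0 \in B /\ forall x y, x \in B -> y \in B -> x - y \in B.

Lemma subgroup0 B : subgroup B -> 0 \in B. Proof. by case. Qed.

Lemma subgroupN B x : subgroup B -> (- x \in B) = (x \in B).
Proof.
move=> [B0 BB]; have N y : y \in B -> - y \in B by rewrite -sub0r; apply: BB.
by apply/idP/idP => /N; rewrite ?opprK.
Qed.

Lemma subgroupDr B x y : subgroup B -> y \in B -> (x + y \in B) = (x \in B).
Proof.
move=> sB yB; have [_ BB] := sB; apply/idP/idP => xB.
  by rewrite -(addrK y x) BB.
by rewrite -[y]opprK BB // subgroupN.
Qed.

Lemma orthP B x : reflect (forall y, y \in B -> dot x y = 0) (x \in orth B).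
Proof.
rewrite inE; apply: (iffP forallP) => [H y yB|H y].
  by apply/eqP; have := H y; rewrite yB.
by apply/implyP => yB; rewrite H.
Qed.

Lemma orth_subgroup B : subgroup (orth B).
Proof.
split; first by apply/orthP => y _; apply: dot0l.
by move=> x y /orthP xB /orthP yB; apply/orthP => t tB; rewrite dotDl dotNl xB ?yB ?subrr.
Qed.

Lemma subgroup_setT : subgroup [set: 'rV[F]_n].
Proof. by split=> [|x y _ _]; rewrite inE. Qed.

Lemma orth_setT : orth [set: 'rV[F]_n] = [set 0].
Proof.
apply/setP => x; rewrite in_set1; apply/idP/eqP => [/orthP H|->].
  by apply: dot_nondeg => y; apply: H; rewrite inE.
by case: (orth_subgroup [set: 'rV[F]_n]).
Qed.

End Dot.

Section CharacterSums.
Variables (C : numClosedFieldType) (p n : nat) (z : C).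
Hypotheses (p_prime : prime p) (zP : p.-primitive_root z).
Local Notation e := (@zchar C p z).
Local Notation V := 'rV['F_p]_n.
Implicit Types (x y : V) (B : {set V}).

Lemma card_rV : #|{: V}| = (p ^ n)%N.
Proof. by rewrite card_mx card_Fp // mul1n. Qed.

Lemma sum_subgroup B x : subgroup B ->
  \sum_(y in B) e (dot x y) = if x \in orth B then #|B|%:R else 0.
Proof.
move=> sB; case: ifPn => [/orthP xB|].
  by under eq_bigr => y yB do rewrite xB // zchar0; rewrite sumr_const.
rewrite inE negb_forall => /existsP[t]; rewrite negb_imply => /andP[tB xt].
set s := \sum_(y in B) _; have e1 : e (dot x t) * s = s.
  rewrite mulr_sumr [RHS](reindex_inj (addIr t)) /=; apply: eq_big => y.
    by rewrite subgroupDr.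
  by move=> _; rewrite dotDr zcharD // mulrC.
apply/eqP; move/eqP: e1; rewrite -subr_eq0 -{2}[s]mul1r -mulrBl mulf_eq0.
by rewrite subr_eq0 zchar_eq1 // (negPf xt).
Qed.

Lemma sum_dot x : \sum_y e (dot x y) = if x == 0 then (p ^ n)%:R else 0.
Proof.
have := sum_subgroup x (@subgroup_setT _ n); rewrite orth_setT in_set1 cardsT card_rV => <-.
by apply: eq_bigl => y; rewrite inE.
Qed.

Lemma fourier_inv (F : V -> C) x :
  \sum_y (\sum_t F t * e (- dot y t)) * e (dot y x) = (p ^ n)%:R * F x.
Proof.
under eq_bigr => y _ do rewrite mulr_suml.
rewrite exchange_big /= (bigD1 x) //= [X in _ + X]big1 ?addr0 => [|t tx].
  under eq_bigr => y _ do rewrite -mulrA -zcharD // addNr zchar0 mulr1.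
  by rewrite sumr_const card_rV mulr_natl.
under eq_bigr => y _ do rewrite -mulrA -zcharD // addrC -dotBr dotC.
by rewrite -mulr_sumr sum_dot subr_eq0 eq_sym (negPf tx) mulr0.
Qed.

Lemma fourier_inj (F G : V -> C) :
  (forall y, \sum_t F t * e (- dot y t) = \sum_t G t * e (- dot y t)) -> F =1 G.
Proof.
move=> FG x; have pn : (p ^ n)%:R != 0 :> C.
  by rewrite pnatr_eq0 -lt0n expn_gt0 prime_gt0.
apply: (mulfI pn); rewrite -!fourier_inv.
by apply: eq_bigr => y _; rewrite FG.
Qed.

Lemma card_orth B : subgroup B -> (#|B| * #|orth B| = p ^ n)%N.
Proof.
move=> sB; apply/eqP; rewrite -(eqr_nat C); apply/eqP.
have <- : \sum_x \sum_(y in B) e (dot x y) = (#|B| * #|orth B|)%:R.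
  under eq_bigr => x _ do rewrite sum_subgroup //.
  by rewrite -big_mkcond sumr_const mulrnA.
rewrite exchange_big /=; under eq_bigr => y _.
  under eq_bigr => x _ do rewrite dotC.
  rewrite sum_dot; over.
rewrite (bigD1 0) ?subgroup0 //= eqxx big1 ?addr0 // => y /andP[_ /negPf ->] //.
Qed.

Lemma orthK B : subgroup B -> orth (orth B) = B.
Proof.
move=> sB; have sub : B \subset orth (orth B).
  by apply/subsetP => x xB; apply/orthP => y /orthP yB; rewrite dotC yB.
apply/eqP; rewrite eq_sym eqEcard sub /=.
have := card_orth (orth_subgroup B); rewrite -(card_orth sB) mulnC => /eqP.
rewrite eqn_pmul2r => [/eqP ->//|].
by apply/card_gt0P; exists 0; apply: subgroup0 (orth_subgroup B).
Qed.

Lemma fourier_set B y : \sum_t (t \in B)%:R * e (- dot y t) = \sum_(t in B) e (- dot y t).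
Proof.
rewrite [RHS]big_mkcond; apply: eq_bigr => t _.
by case: (t \in B); rewrite ?mul1r ?mul0r.
Qed.

Lemma fourier_conv (A B : {set V}) y :
  \sum_t #|[set s in A | t - s \in B]|%:R * e (- dot y t) =
  (\sum_(s in A) e (- dot y s)) * (\sum_(s in B) e (- dot y s)).
Proof.
have E t : #|[set s in A | t - s \in B]|%:R = \sum_(s in A) (t - s \in B)%:R :> C.
  rewrite -sum1_card natr_sum big_mkcond [RHS]big_mkcond; apply: eq_bigr => s _.
  by rewrite inE; case: (s \in A) => //=; case: (_ \in B).
under eq_bigr => t _ do rewrite E mulr_suml.
rewrite exchange_big mulr_suml; apply: eq_bigr => s _ /=.
rewrite -fourier_set mulr_sumr (reindex_inj (addIr s)) /=; apply: eq_bigr => t _.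
by rewrite addrK dotDr opprD zcharD // mulrA mulrC.
Qed.

(* If the Fourier transforms of the [d + 1] blocks are constant on the fibers
   of a map with at most [d + 1] values, then, being linearly independent,
   they span all functions constant on these fibers, hence their span is
   closed under pointwise product. *)
Lemma conv_const d (U : 'I_d.+1 -> {set V}) (k : V -> 'I_d.+1) :
  (forall i, U i != set0) -> (forall i j x, x \in U i -> x \in U j -> i = j) ->
  (forall i x y, k x = k y ->
     \sum_(t in U i) e (- dot x t) = \sum_(t in U i) e (- dot y t)) ->
  forall u v w x y, x \in U w -> y \in U w ->
    #|[set s in U u | x - s \in U v]| = #|[set s in U u | y - s \in U v]|.
Proof.
move=> Un0 Udis Uk u v; pose h i x := \sum_(t in U i) e (- dot x t).
pose M : 'M[C]_d.+1 := \matrix_(i, j) h i (odflt 0 [pick x | k x == j]).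
have ME i x : M i (k x) = h i x.
  rewrite mxE; case: pickP => [y /eqP ky|/(_ x)]; last by rewrite eqxx.
  exact: Uk.
have indep (c : 'rV[C]_d.+1) x w : x \in U w -> \sum_i c 0 i * (x \in U i)%:R = c 0 w.
  move=> xw; rewrite (bigD1 w) //= xw mulr1 big1 ?addr0 // => i iw.
  have [xi|_] := boolP (x \in U i); last by rewrite mulr0.
  by case/eqP: iw; apply: Udis xi xw.
have hE (c : 'rV[C]_d.+1) x : \sum_i c 0 i * h i x =
    \sum_t (\sum_i c 0 i * (t \in U i)%:R) * e (- dot x t).
  under [RHS]eq_bigr => t _ do rewrite mulr_suml.
  rewrite exchange_big /=; apply: eq_bigr => i _.
  by under eq_bigr => t _ do rewrite -mulrA; rewrite -mulr_sumr fourier_set.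
have Minv : M \in unitmx.
  rewrite -row_free_unit; apply: inj_row_free => c cM; apply/rowP => w.
  rewrite mxE; have [x xw] := set0Pn _ (Un0 w); rewrite -(indep _ x w xw).
  apply: (fourier_inj (G := fun=> 0) (F := fun t => \sum_i c 0 i * (t \in U i)%:R)) => y.
  rewrite -hE [RHS]big1 => [|t _]; last exact: mul0r.
  have := congr1 (fun N : 'rV_d.+1 => N 0 (k y)) cM; rewrite !mxE => E.
  by rewrite -[RHS]E; apply: eq_bigr => i _; rewrite ME.
pose c := (\row_j (M u j * M v j)) *m invmx M.
have cM : c *m M = \row_j (M u j * M v j) by rewrite mulmxKV.
have cntE x w : x \in U w -> #|[set s in U u | x - s \in U v]|%:R = c 0 w.
  move=> xw; rewrite -(indep _ x w xw).
  apply: (fourier_inj (F := fun t => #|[set s in U u | t - s \in U v]|%:R)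
     (G := fun t => \sum_i c 0 i * (t \in U i)%:R)) => y.
  rewrite fourier_conv -hE -[_ * _]/(h u y * h v y) -!ME.
  have := congr1 (fun N : 'rV_d.+1 => N 0 (k y)) cM; rewrite !mxE => <-.
  by apply: eq_bigr => i _; rewrite ME.
move=> w x y xw yw; apply/eqP; rewrite -(eqr_nat C); apply/eqP.
by rewrite !(cntE _ w).
Qed.

Section Labels.
Variables (L : finType) (D : {set L}) (lab : V -> L).
Hypothesis lab_im : [set lab x | x : V] = D.

Definition fibers := [set [set x | lab x == l] | l in D].

Lemma fibers_partition : partition fibers [set: V].
Proof.
apply/and3P; split.
- rewrite eqEsubset subsetT; apply/subsetP => x _; apply/bigcupP.
  exists [set y | lab y == lab x]; last by rewrite inE.
  by apply: imset_f; rewrite -lab_im imset_f.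
- apply/trivIsetP => A B /imsetP[l _ ->] /imsetP[l' _ ->] AB.
  rewrite -setI_eq0; apply: contraNT AB => /set0Pn[x]; rewrite !inE => /andP[].
  by move=> /eqP -> /eqP ->.
- apply/imsetP => -[l]; rewrite -lab_im => /imsetP[x _ ->] /setP/(_ x).
  by rewrite !inE eqxx.
Qed.

Lemma fibers_scheme d (D' : {set L}) (lab' : V -> L) :
  #|D| = d.+1 -> (#|D'| <= #|D|)%N -> (forall x, lab' x \in D') ->
  (forall x, lab x = lab 0 -> x = 0) -> (forall x, lab (- x) = lab x) ->
  (forall l x y, lab' x = lab' y ->
    \sum_(t in [set t | lab t == l]) e (- dot x t) =
    \sum_(t in [set t | lab t == l]) e (- dot y t)) ->
  induces_sym_scheme d fibers.
Proof.
(* The label of 0 is listed first, so that the block numbered 0 is {0}. *)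
move=> cD cD' lab'D lab0 labN labk; pose s := lab 0 :: enum (D :\ lab 0).
have l0D : lab 0 \in D by rewrite -lab_im imset_f.
have us : uniq s by rewrite /= mem_enum !inE eqxx enum_uniq.
have ms l : (l \in s) = (l \in D).
  by rewrite inE mem_enum !inE; have [->|] := eqVneq l (lab 0).
have zs : size s = d.+1.
  by rewrite -cD /= -cardE [RHS](cardsD1 (lab 0)) l0D.
pose l (i : 'I_d.+1) := nth (lab 0) s i.
have lD i : l i \in D by rewrite -ms mem_nth // zs.
have l_inj : injective l.
  move=> i j /eqP; rewrite nth_uniq ?zs // => /eqP; exact: ord_inj.
have lex x : exists i, l i = lab x.
  have xs : lab x \in s by rewrite ms -lab_im imset_f.
  have ix : (index (lab x) s < d.+1)%N by rewrite -zs index_mem.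
  by exists (Ordinal ix); rewrite /l nth_index.
pose U i := [set x | lab x == l i].
have Un0 i : U i != set0.
  have := lD i; rewrite -lab_im => /imsetP[x _ lx].
  by apply/set0Pn; exists x; rewrite inE lx.
have Udis i j x : x \in U i -> x \in U j -> i = j.
  by rewrite !inE => /eqP -> /eqP /l_inj.
have UN i x : (- x \in U i) = (x \in U i) by rewrite !inE labN.
have sub i a b : (b - a \in U i) = (a - b \in U i) by rewrite -UN opprB.
pose k x : 'I_d.+1 := inord (index (lab' x) (enum D')).
have kE x y : k x = k y -> lab' x = lab' y.
  have lt t : (index (lab' t) (enum D') < d.+1)%N.
    by rewrite -cD (leq_trans _ cD') // cardE index_mem mem_enum.
  move/(congr1 val); rewrite /= !inordK // => /(congr1 (nth (lab 0) (enum D'))).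
  by rewrite !nth_index ?mem_enum.
have cc := conv_const Un0 Udis (fun i x y kxy => labk (l i) x y (kE x y kxy)).
exists U; split.
- by move=> i j UU; have [x xi] := set0Pn _ (Un0 i); apply: (Udis _ _ x xi); rewrite -UU.
- apply/setP => A; apply/imsetP/imsetP => [[l']|[i _ ->]].
    rewrite -lab_im => /imsetP[x _ ->] ->; have [i li] := lex x.
    by exists i; rewrite // /U li.
  by exists (l i).
- apply/setP => x; rewrite !inE; apply/eqP/eqP => [/lab0 //|->//].
split; last first.
  by move=> j; apply/setP => -[a b]; rewrite !inE /= -[b - a]opprB labN.
split.
- split; first by apply/card_gt0P; exists 0.
  + move=> i; have [x xi] := set0Pn _ (Un0 i); apply/set0Pn; exists (x, 0).
    by rewrite inE /= subr0.
  + move=> i j; apply: contraR => /pred0Pn[[a b]] /= /andP[].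
    by rewrite !inE /= => abi abj; apply/eqP/(Udis _ _ (a - b)); rewrite inE.
  + apply/setP => -[a b]; rewrite inE; apply/bigcupP.
    by have [i li] := lex (a - b); exists i; rewrite // !inE /= li.
- apply/setP => -[a b]; rewrite !inE /= -[RHS]subr_eq0.
  by apply/eqP/eqP => [/lab0 //|->].
- by move=> j; exists j; apply/setP => -[a b]; rewrite !inE /= -[b - a]opprB labN.
(* The count is taken at an arbitrary representative of [U w]; the default 0 is not reached, as x -
   y lies in [U w]. *)
exists (fun u v w => #|[set t in U u | odflt 0 [pick x in U w] - t \in U v]|).
move=> u v w x y; rewrite inE /= => xyw.
have -> : #|[set t in U u | odflt 0 [pick x in U w] - t \in U v]| =
    #|[set t in U u | (x - y) - t \in U v]|.
  apply: (cc u v w) => //; case: pickP => [t //|/(_ (x - y))].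
  by rewrite xyw.
(* The reflection t -> x - t carries the decompositions of x - y counted by [conv_const] to the
   points required by the scheme. *)
rewrite -(card_imset _ (subrI x)); apply: eq_card => t.
apply/imsetP/idP => [[s']|].
  by rewrite !inE /= => + ->; rewrite [x - y]addrC addrKA opprK [- y + _]addrC.
rewrite inE => /andP[tu tv]; exists (x - t); last by rewrite subKr.
by move: tu tv; rewrite !inE /= subKr => -> /=; rewrite addrAC.
Qed.

End Labels.
End CharacterSums.

(** * Duality of bent functions *)

Section Duality.
Variables (C : numClosedFieldType) (p n : nat) (z : C).
Hypotheses (p_prime : prime p) (p_odd : odd p) (n_odd : odd n).
Hypothesis zP : p.-primitive_root z.
Local Notation e := (@zchar C p z).
Local Notation V := 'rV['F_p]_n.
Local Notation m := p./2.
Local Notation G := (p%:R ^+ n./2 * gauss p z).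

Lemma Gsqr : G ^+ 2 = (-1) ^+ m * (p ^ n)%:R.
Proof.
rewrite exprMn (gauss_sqr p_prime p_odd zP) mulrCA -exprM -exprSr natrX.
by rewrite [n in RHS](half_double n_odd).
Qed.

Lemma G_neq0 : G != 0.
Proof.
have : G ^+ 2 != 0; last by rewrite expf_eq0.
by rewrite Gsqr mulf_eq0 signr_eq0 pnatr_eq0 expn_eq0 (gtn_eqF (prime_gt0 p_prime)).
Qed.

Lemma Fp_third (a b : 'F_p) : exists j, (j != a) && (j != b).
Proof.
apply/existsP; apply: contraT => /existsPn H.
have : (#|'F_p| <= #|[set a; b]|)%N.
  apply: subset_leq_card; apply/subsetP => j _; rewrite !inE.
  by have := H j; rewrite negb_and !negbK.
rewrite card_Fp // cards2; have := half_double p_odd; have := half_gt0 p_prime p_odd.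
case: (a == b) => /=; lia.
Qed.

(* Modulo 2 the left-hand side vanishes, so the two characters on the right,
   which have odd coefficients, must cancel. *)
Lemma parity_match (I : finType) (D : {set I}) (u : I -> 'F_p) (d : bool) a b :
  (\sum_(i in D) e (u i)) *+ 2 = G * ((-1) ^+ d * e a - e b) -> a = b.
Proof.
move=> E; apply/eqP; apply: contraT => ab.
have [q qE] := ev_unfold z (fun j : 'F_p => #|[set i in D | u i == j]|%:Z).
have [c cE] := ev_fold p_prime zP (q * (p%:Z ^+ n./2)%:P * gauss_poly p).
have {cE} cE : (\sum_j (c j)%:~R * e j) *+ 2 =
    ((-1) ^+ m * (p ^ n)%:R) * ((-1) ^+ d * e a - e b).
  rewrite -cE !rmorphM /= ev_gauss_poly qE horner_morphC rmorphXn /= -mulrA mulrC.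
  rewrite -sum_level -mulrnAr E mulrA -expr2 Gsqr //.
have c0 : \sum_j ((c j) *+ 2 - (-1) ^+ m * (p ^ n)%:Z *
    ((-1) ^+ d * (j == a)%:R - (j == b)%:R))%:~R * e j = 0.
  under eq_bigr => j _ do rewrite rmorphB rmorphMn mulrBl mulrnAl.
  rewrite sumrB sumrMnl /= cE; apply/eqP; rewrite subr_eq0; apply/eqP.
  have one b0 : \sum_j (j == b0)%:R * e j = e b0.
    by rewrite (bigD1 b0) //= eqxx mul1r big1 ?addr0 // => j /negPf ->; rewrite mul0r.
  rewrite -(one a) -(one b) mulr_sumr -sumrB mulr_sumr; apply: eq_bigr => j _.
  rewrite !rmorphM rmorphB rmorphM /= !rmorph_sign /= mulrA -mulrBl mulrA.
  by rewrite !rmorph_nat.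
have [j /andP[ja jb]] := Fp_third a b.
have := zchar_lin0 p_prime zP c0 a j; rewrite eqxx (negPf ab) (negPf ja) (negPf jb) /=.
rewrite mulr0 subrr mulr0 !subr0 mulr1 => /eqP; rewrite subr_eq addrC -subr_eq.
rewrite -mulrnBl => /eqP/(congr1 absz)/(congr1 odd).
by rewrite -mulr_natr !abszM !abszX !oddM !oddX p_odd andbF !orbT.
Qed.

Variables (f g g' : V -> 'F_p) (S T : {set V}).
Local Notation sg B x := ((-1) ^+ (x \in (B : {set V})) : C).
(* The factor [(-1) ^+ m] is [1] for [p = 1 %[mod 4]] and [-1] for
   [p = 3 %[mod 4]], so [S] stands for [B_-(f)] in the first case and for
   [B_+(f)] in the second. *)
Hypothesis Wf : forall a, \sum_x e (f x - dot a x) = sg S a * ((-1) ^+ m * G) * e (g a).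
Hypothesis Wg : forall x, \sum_a e (g a - dot x a) = sg T x * G * e (g' x).
Hypothesis TN : forall x, (- x \in T) = (x \in T).

(** Fourier inversion of [Wf]. The product of G and [(-1) ^+ m * G] is p^n, so the sign chosen in
    [Wf] is exactly the one that disappears here. *)
Lemma sum_sign_dual x :
  \sum_a sg S a * e (g a + dot a x) = G * e (f x).
Proof.
have s0 : (-1) ^+ m * G != 0 by rewrite mulf_neq0 ?signr_eq0 // G_neq0.
apply: (mulfI s0); rewrite [RHS]mulrA -[_ * G * G]mulrA -expr2 Gsqr signrMK.
rewrite -(fourier_inv p_prime zP (fun t => e (f t))) mulr_sumr; apply: eq_bigr => a _.
under eq_bigr => t _ do rewrite -zcharD //.
by rewrite Wf zcharD // mulrCA !mulrA.
Qed.

(** The difference between the plain sum [Wg] at - x and the signed sum [sum_sign_dual]: the terms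
    outside [S] cancel and those in [S] double. This factor 2 is what [parity_match] exploits. *)
Lemma sum_sub_dual x :
  (\sum_(a in S) e (g a + dot a x)) *+ 2 = G * (sg T x * e (g' (- x)) - e (f x)).
Proof.
rewrite mulrBr -sum_sign_dual mulrCA mulrA -(TN x) -Wg.
under [X in _ = X - _]eq_bigr => a _ do rewrite dotNl opprK dotC.
rewrite -sumrB -sumrMnl big_mkcond; apply: eq_bigr => a _.
case: (a \in S); last by rewrite mul1r subrr.
by rewrite expr1 mulN1r opprK mulr2n.
Qed.

Lemma dual_dual x : g' (- x) = f x.
Proof. exact: (parity_match (sum_sub_dual x)). Qed.

(** By [dual_dual] the two exponentials in [sum_sub_dual] coincide, so they cancel outside [T] and
    add up on [T]. *)
Lemma sum_S x :
  \sum_(a in S) e (g a + dot a x) = if x \in T then - G * e (f x) else 0.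
Proof.
have two : 2%:R != 0 :> C by rewrite pnatr_eq0.
apply: (mulIf two); rewrite mulr_natr sum_sub_dual dual_dual.
case: ifP => _; last by rewrite mul1r subrr mulr0 mul0r.
by rewrite expr1; ring.
Qed.

(** Fourier inversion of [sum_S], seen as the transform of the function equal to [e (g a)] on [S]
    and 0 elsewhere. *)
Lemma sum_T a : \sum_(x in T) e (f x - dot a x) =
  if a \in S then - ((-1) ^+ m * G) * e (g a) else 0.
Proof.
have := fourier_inv p_prime zP (fun t => (t \in S)%:R * e (g t)) a.
rewrite (reindex_inj oppr_inj) /=.
have inner x : \sum_t (t \in S)%:R * e (g t) * e (- dot (- x) t) * e (dot (- x) a) =
    if x \in T then - G * e (f x - dot a x) else 0.
  transitivity ((\sum_(t in S) e (g t + dot t x)) * e (- dot a x)).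
    rewrite mulr_suml [RHS]big_mkcond; apply: eq_bigr => t _.
    rewrite !dotNl opprK (dotC x t) (dotC x a).
    by case: (t \in S); rewrite ?mul0r // mul1r zcharD.
  by rewrite sum_S; case: ifP => _; rewrite ?mul0r // zcharD // mulrA.
under eq_bigr => x _ do rewrite mulr_suml inner.
rewrite -big_mkcond -mulr_sumr => /(canRL (mulKf _)) -> //; last by rewrite oppr_eq0 G_neq0.
have GG : (p ^ n)%:R = G * ((-1) ^+ m * G).
  by rewrite mulrCA -expr2 Gsqr signrMK.
case: (a \in S); last by rewrite mul0r !mulr0.
rewrite mul1r GG invrN; have := G_neq0; move: G => H H0.
by field.
Qed.

Lemma sum_TC a : \sum_(x in ~: T) e (f x - dot a x) =
  if a \in S then 0 else (-1) ^+ m * G * e (g a).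
Proof.
have := Wf a; rewrite (bigID (fun x => x \in T)) /= sum_T => /(canRL (addKr _)) E.
under eq_bigl => x do rewrite inE.
by rewrite E; case: (a \in S); rewrite ?expr1 ?expr0; ring.
Qed.

End Duality.

Lemma card_involution_even (T : finType) (A : {set T}) (s : T -> T) :
  involutive s -> (forall x, x \in A -> s x \in A) -> (forall x, x \in A -> s x != x) ->
  ~~ odd #|A|.
Proof.
move=> sK; have [k] := ubnP #|A|; elim: k A => // k IH A lek sA sfix.
have [->|[x xA]] := set_0Vmem A; first by rewrite cards0.
have sx := sfix x xA; have sxA : s x \in A :\ x by rewrite !inE sx sA.
have cA : #|A| = #|A :\ x :\ s x|.+2.
  by rewrite (cardsD1 x) xA (cardsD1 (s x) (A :\ x)) sxA.
rewrite cA /= negbK; apply: IH.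
- by move: lek; rewrite cA; lia.
- move=> y; rewrite !inE => /and3P[ysx yx yA]; rewrite sA // andbT.
  by rewrite (inj_eq (inv_inj sK)) yx /=; apply: contra ysx => /eqP <-; rewrite sK.
- by move=> y; rewrite !inE => /and3P[_ _]; apply: sfix.
Qed.

Section Labels.
Variables (F : finFieldType) (n : nat).
Local Notation V := 'rV[F]_n.
Local Notation L := (option (option (bool * F))).

(* [None] labels [{0}], [Some None] labels [K] minus [0], and
   [Some (Some (b, j))] the remaining points of the level set [u = j] inside
   ([b = true]) or outside ([b = false]) [B]. *)
Definition block_label (K B : {set V}) (u : V -> F) (x : V) : L :=
  if x == 0 then None else if x \in K then Some None else Some (Some (x \in B, u x)).

(** The labels that are to occur: every level is met outside [B], while inside [B] only the levels
    in [D] are, so [D] is what distinguishes the four partitions. *)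
Definition labels (D : {set F}) : {set L} :=
  [set l | if l is Some (Some (true, j)) then j \in D else true].

Lemma labelsE D : labels D = [set None] :|: [set Some (Some (false, j)) | j : F]
  :|: [set Some None] :|: [set Some (Some (true, j)) | j in D].
Proof.
have same (b : bool) (A : {pred F}) j :
    (Some (Some (b, j)) \in [set Some (Some (b, i)) | i in A]) = (j \in A).
  by apply/imsetP/idP => [[i iA [->]]|jA] //; exists j.
have dis (b b' : bool) (A : {pred F}) j : b != b' ->
    (Some (Some (b, j)) \in [set Some (Some (b', i)) | i in A]) = false.
  by move=> bb; apply/imsetP => -[i _ [bb' _]]; rewrite bb' eqxx in bb.
apply/setP => -[[[[] j]|]|]; rewrite !inE.
- by rewrite dis // same.
- by rewrite same.
- by rewrite eqxx orbT.
- by [].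
Qed.

Lemma card_labels D : #|labels D| = (#|F| + #|D|).+2.
Proof.
have i1 (b : bool) : injective (fun j : F => Some (Some (b, j))) by move=> i j [].
have cU (A B : {set L}) : (forall x, x \in A -> x \notin B) -> #|A :|: B| = (#|A| + #|B|)%N.
  move=> AB; rewrite cardsU; have -> : A :&: B = set0; last by rewrite cards0 subn0.
  by apply/setP => x; rewrite !inE; case xA: (x \in A); rewrite //= (negPf (AB x xA)).
rewrite labelsE !cU.
- by rewrite !cards1 !(card_imset _ (i1 _)) addn1 add1n addSn.
- by move=> x /set1P ->; apply/imsetP => -[].
- by move=> x /setUP[/set1P ->|/imsetP[j _ ->]]; rewrite inE.
- by move=> x /setUP[/setUP[/set1P ->|/imsetP[j _ ->]]|/set1P ->]; apply/imsetP => -[].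
Qed.

End Labels.

(** * Level counts and transforms of the blocks *)

Section DualPair.
Variables (C : numClosedFieldType) (p n r : nat) (z : C).
Hypotheses (p_prime : prime p) (p_odd : odd p) (n_odd : odd n).
Hypothesis zP : p.-primitive_root z.
Local Notation e := (@zchar C p z).
Local Notation V := 'rV['F_p]_n.
Local Notation m := p./2.
Local Notation G := (p%:R ^+ n./2 * gauss p z).

(** The Gauss sum times [e c] has the shifted Legendre symbols as coefficients, so by [zchar_lin0]
    the level counts match them up to a constant, which is the count at [c]. The symbols sum to 0,
    whence the size of [D]. *)
Lemma level_gauss (D : {set V}) (u : V -> 'F_p) (d : bool) c :
  \sum_(x in D) e (u x) = (-1) ^+ d * G * e c ->
  (forall j, #|[set x in D | u x == j]|%:Z =
     #|[set x in D | u x == c]|%:Z + (-1) ^+ d * (p ^ n./2)%:Z * legendre (j - c)) /\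
  (#|D| = p * #|[set x in D | u x == c]|)%N.
Proof.
rewrite (sum_level D u e) => E.
have gc : gauss p z * e c = \sum_j (legendre (j - c))%:~R * e j.
  rewrite mulr_suml [RHS](reindex_inj (addIr c)); apply: eq_bigr => j _ /=.
  by rewrite addrK zcharD // mulrA.
have : \sum_j (#|[set x in D | u x == j]|%:Z -
    (-1) ^+ d * (p ^ n./2)%:Z * legendre (j - c))%:~R * e j = 0.
  under eq_bigr => j _ do rewrite rmorphB mulrBl.
  rewrite sumrB /= E -!mulrA gc !mulr_sumr -sumrB big1 // => j _.
  rewrite rmorphM rmorphM rmorph_sign /= !mulrA -natrX; exact: subrr.
move/(zchar_lin0 p_prime zP) => H.
have N j : #|[set x in D | u x == j]|%:Z =
     #|[set x in D | u x == c]|%:Z + (-1) ^+ d * (p ^ n./2)%:Z * legendre (j - c).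
  by apply/eqP; rewrite -subr_eq (H j c) subrr legendre0 mulr0 subr0.
split=> //; apply/eqP; rewrite -eqz_nat; apply/eqP.
have -> : #|D|%:Z = \sum_j #|[set x in D | u x == j]|%:Z.
  have := sum_level D u (fun=> 1 : int); rewrite sumr_const natz => ->.
  by apply: eq_bigr => j _; rewrite mulr1 natz.
under eq_bigr => j _ do rewrite N.
rewrite big_split /= sumr_const card_Fp // -mulr_sumr.
have -> : \sum_(j : 'F_p) legendre (j - c) = 0.
  rewrite (reindex_inj (addIr c)) -[RHS](sum_legendre p_prime p_odd).
  by apply: eq_bigr => j _ /=; rewrite addrK.
by rewrite mulr0 addr0 -mulr_natl natz PoszM.
Qed.

Variables (f g : V -> 'F_p) (S T : {set V}).
Hypothesis sumS : forall x,
  \sum_(a in S) e (g a + dot a x) = if x \in T then - G * e (f x) else 0.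
Hypothesis sumT : forall a, \sum_(x in T) e (f x - dot a x) =
  if a \in S then - ((-1) ^+ m * G) * e (g a) else 0.
Hypothesis sumTC : forall a, \sum_(x in ~: T) e (f x - dot a x) =
  if a \in S then 0 else (-1) ^+ m * G * e (g a).
Hypotheses (subS : subgroup S) (subT : subgroup T).
Hypotheses (cardS : #|S| = (p ^ r)%N) (cardT : #|T| = (p ^ r)%N).
Hypotheses (f0 : f 0 = 0) (fN : forall x, f (- x) = f x).
Hypothesis fhom : forall y, y != 0 ->
  exists2 a, a != 0 & forall x, y * f x = a^-1 * f (a *: x).
Hypothesis TZ : forall a x, a != 0 -> (a *: x \in T) = (x \in T).
Hypotheses (r_half : (n./2 < r)%N) (r_lt : (r < n)%N).

Let Gn0 : G != 0 := G_neq0 p_prime p_odd n_odd zP.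
Let T0 : 0 \in T := subgroup0 subT.
Let S0 : 0 \in S := subgroup0 subS.

(** For [x] orthogonal to [S] the sum in [sumS] is the same as at 0, where it is nonzero because 0
    lies in [T]; comparing the two values gives both claims. *)
Lemma orthS_T x : x \in orth S -> x \in T /\ f x = 0.
Proof.
move/orthP => xS; have := sumS x.
under eq_bigr => a aS do rewrite dotC xS // -(dot0r a).
rewrite sumS T0 f0 zchar0 mulr1; case: ifP => xT /eqP; last by rewrite oppr_eq0 (negPf Gn0).
rewrite -[X in X == _]mulr1 (inj_eq (mulfI _)) ?oppr_eq0 // eq_sym zchar_eq1 // => /eqP.
by [].
Qed.

Lemma orthT_S a : a \in orth T -> a \in S /\ g a = g 0.
Proof.
move/orthP => aT; have := sumT a.
under eq_bigr => x xT do rewrite aT // -(dot0l x).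
have s0 : - ((-1) ^+ m * G) != 0 by rewrite oppr_eq0 mulf_neq0 ?signr_eq0.
rewrite sumT S0; case: ifP => aS /eqP; last by rewrite mulf_eq0 (negPf s0) (negPf (zchar_neq0 p_prime zP _)).
by rewrite (inj_eq (mulfI s0)) (inj_eq (zchar_inj p_prime zP)) => /eqP.
Qed.

Lemma sumT0 : \sum_(x in T) e (f x) = (-1) ^+ (~~ odd m) * G * e (g 0).
Proof.
have := sumT 0; rewrite S0; under eq_bigr => x _ do rewrite dot0l subr0.
by move=> ->; rewrite -signr_odd; case: odd; rewrite /= ?expr0 ?expr1; ring.
Qed.

Lemma levelT_even j : j != 0 -> ~~ odd #|[set x in T | f x == j]|.
Proof.
move=> j0; apply: (card_involution_even (s := -%R)); first exact: opprK.
  by move=> x; rewrite !inE subgroupN // fN.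
move=> x; rewrite inE => /andP[_ /eqP fx]; apply: contraNneq j0 => xx.
rewrite -fx -f0; suff -> : x = 0 by [].
have : 2%:R *: x = 0 by rewrite scaler_nat mulr2n -{1}xx addNr.
move/eqP; rewrite scaler_eq0 => /orP[|/eqP //].
rewrite -(dvdn_pcharf (pchar_Fp p_prime)) => /(dvdn_leq (isT : 0 < 2)%N).
by have := half_double p_odd; have := half_gt0 p_prime p_odd; lia.
Qed.

(** The level of [g 0] has |T|/p points, an odd number. A level j != 0 has an even number, since x
    -> - x acts on it without fixed points. *)
Lemma dual0 : g 0 = 0.
Proof.
apply/eqP; apply: contraT => c0; have [N cT] := level_gauss sumT0.
have := levelT_even c0; have -> : odd #|[set x in T | f x == g 0]|.
  by have := congr1 odd cT; rewrite cardT oddM oddX p_odd orbT /= => <-.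
by [].
Qed.

Lemma levelT j : #|[set x in T | f x == j]|%:Z =
  (p ^ r.-1)%:Z - (-1) ^+ m * (p ^ n./2)%:Z * legendre j.
Proof.
have [N cT] := level_gauss sumT0; rewrite dual0 in N cT.
have E : #|[set x in T | f x == 0]| = (p ^ r.-1)%N.
  apply/eqP; rewrite -(eqn_pmul2l (prime_gt0 p_prime)) -cT cardT -expnS.
  by rewrite prednK // (leq_ltn_trans _ r_half).
rewrite N E subr0 -[in RHS]signr_odd; congr (_ + _).
by case: odd; rewrite /= ?expr0 ?expr1; ring.
Qed.

Lemma levelS j : #|[set a in S | g a == j]|%:Z =
  (p ^ r.-1)%:Z - (p ^ n./2)%:Z * legendre j.
Proof.
have E0 : \sum_(a in S) e (g a) = (-1) ^+ true * G * e 0.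
  have := sumS 0; rewrite T0 f0; under eq_bigr => a _ do rewrite dot0r addr0.
  by move=> ->; rewrite expr1 mulN1r.
have [N cS] := level_gauss E0.
have E : #|[set x in S | g x == 0]| = (p ^ r.-1)%N.
  apply/eqP; rewrite -(eqn_pmul2l (prime_gt0 p_prime)) -cS cardS -expnS.
  by rewrite prednK // (leq_ltn_trans _ r_half).
by rewrite N E subr0 expr1 mulN1r mulNr.
Qed.

(** As 0 lies in [S], the sum of [e (f x)] outside [T] vanishes, so all levels there have equal
    size; they are not all empty because r < n. *)
Lemma levelTC j : exists2 x, x \notin T & f x = j.
Proof.
have : \sum_(x in ~: T) e (f x) = \sum_(x in set0) e (f (x : V)).
  have := sumTC 0; rewrite S0 big_set0; under eq_bigr => x _ do rewrite dot0l subr0.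
  by [].
move/(level_diff p_prime zP) => H.
have [x] : exists x, x \in ~: T.
  apply/existsP; apply: contraTT r_lt => /existsPn xT; rewrite -leqNgt.
  rewrite -(leq_exp2l _ _ (prime_gt1 p_prime)) -cardT -(card_rV n p_prime) -cardsT.
  by apply: subset_leq_card; apply/subsetP => x _; have := xT x; rewrite inE negbK.
have s0 k : [set x in set0 | f x == k] = set0 by apply/setP => y; rewrite !inE.
rewrite inE => xT; have := H j (f x); rewrite !s0 cards0 !subr0 => /eqP.
rewrite eqz_nat => /eqP E.
have : (0 < #|[set x in ~: T | f x == j]|)%N.
  by rewrite E; apply/card_gt0P; exists x; rewrite !inE xT eqxx.
by case/card_gt0P => y; rewrite !inE => /andP[yT /eqP yj]; exists y.
Qed.

Local Notation lab := (block_label (orth S) T f).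
Local Notation lab' := (block_label (orth T) S g).

Lemma card_orthS : #|orth S| = (p ^ (n - r))%N.
Proof.
have := card_orth p_prime zP subS; rewrite cardS.
have -> : (p ^ n = p ^ r * p ^ (n - r))%N by rewrite -expnD subnKC // ltnW.
by move/eqP; rewrite eqn_pmul2l ?expn_gt0 ?prime_gt0 // => /eqP.
Qed.

Lemma orthS_neq0 : exists2 x, x \in orth S & x != 0.
Proof.
have : (0 < #|orth S :\ (0%R : V)|)%N.
  have : (p ^ 0 < #|orth S|)%N.
    by rewrite card_orthS ltn_exp2l ?prime_gt1 // subn_gt0.
  by rewrite (cardsD1 (0%R : V)) subgroup0 //; apply: orth_subgroup.
by case/card_gt0P => x /setD1P[x0 xS]; exists x.
Qed.

Lemma block_label_im (D : {set 'F_p}) :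
  (forall j, reflect (exists x, [/\ x \in T, x \notin orth S & f x = j]) (j \in D)) ->
  [set lab x | x : V] = labels D.
Proof.
move=> DP; have S1 : 0 \in orth S := subgroup0 (orth_subgroup S).
apply/setP => l; apply/imsetP/idP => [[x _ ->]|].
  rewrite /block_label inE; case: eqVneq => // x0; case: ifPn => // xS.
  by case: ifP => // xT; apply/DP; exists x.
rewrite inE; case: l => [[[[] j]|]|] H.
- have [x [xT xS fx]] := DP j H; exists x; rewrite // /block_label (negPf xS) xT fx.
  by rewrite (negPf (_ : x != 0)) //; apply: contraNneq xS => ->.
- have [x xT fx] := levelTC j; exists x; rewrite // /block_label (negPf xT) fx.
  have /negPf -> : x \notin orth S by apply: contra xT => /orthS_T[].
  by rewrite (negPf (_ : x != 0)) //; apply: contraNneq xT => ->.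
- have [x xS x0] := orthS_neq0; exists x; rewrite // /block_label (negPf x0) xS //.
- by exists 0; rewrite // /block_label eqxx.
Qed.

Lemma block_labelN x : lab (- x) = lab x.
Proof.
by rewrite /block_label oppr_eq0 fN !subgroupN //; apply: orth_subgroup.
Qed.

Lemma block_label0 x : lab x = lab 0 -> x = 0.
Proof.
by rewrite /block_label eqxx; case: eqVneq => // _; case: ifP.
Qed.

(** The indicator of a level is expanded into the characters e(y (f x - j)). For y != 0, homogeneity
    and the change of variable x -> c x make the y-th sum a Galois conjugate of the sum for y = 1,
    so [zchar_gal] reduces everything to y = 0 and y = 1. *)
Lemma sum_level_dual (D : {set V}) a b j :
  (forall c x, c != 0 -> (c *: x \in D) = (x \in D)) ->
  \sum_(x in D) e (- dot a x) = \sum_(x in D) e (- dot b x) ->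
  \sum_(x in D) e (f x - dot a x) = \sum_(x in D) e (f x - dot b x) ->
  \sum_(x in [set x in D | f x == j]) e (- dot a x) =
  \sum_(x in [set x in D | f x == j]) e (- dot b x).
Proof.
move=> DZ E0 E1.
have p0 : p%:R != 0 :> C by rewrite pnatr_eq0 -lt0n prime_gt0.
have expand t : p%:R * \sum_(x in [set x in D | f x == j]) e (- dot t x) =
    \sum_y e (- (y * j)) * \sum_(x in D) e (y * f x - dot t x).
  under [RHS]eq_bigr => y _ do rewrite mulr_sumr.
  rewrite exchange_big mulr_sumr big_set big_mkcondr; apply: eq_bigr => x _ /=.
  have -> : \sum_y e (- (y * j)) * e (y * f x - dot t x) =
      (\sum_y e ((f x - j) * y)) * e (- dot t x).
    rewrite mulr_suml; apply: eq_bigr => y _; rewrite -!zcharD //; congr e; ring.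
  by rewrite sum_zcharM // subr_eq0; case: ifP => _; rewrite ?mul0r.
apply: (mulfI p0); rewrite !expand; apply: eq_bigr => y _; congr (_ * _).
have [->|y0] := eqVneq y 0.
  under eq_bigr => x _ do rewrite mul0r sub0r.
  by under [RHS]eq_bigr => x _ do rewrite mul0r sub0r.
have [c c0 cE] := fhom y0.
have scale t : \sum_(x in D) e (y * f x - dot t x) =
    \sum_(x in D) e (c^-1 * (f x - dot t x)).
  have cI : injective (fun x : V => c *: x) by apply: can_inj (scalerK c0).
  rewrite [RHS](reindex_inj cI) /=; apply: eq_big => x; first by rewrite DZ.
  by rewrite mulrBr -cE dotZr mulKf.
by rewrite !scale; apply: zchar_gal; rewrite ?invr_eq0.
Qed.

Lemma labels_dual l a b : lab' a = lab' b ->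
  \sum_(x in [set x | lab x == l]) e (- dot a x) =
  \sum_(x in [set x | lab x == l]) e (- dot b x).
Proof.
move=> ab.
have zE : (a == 0) = (b == 0).
  by move: ab; rewrite /block_label; case: (a == 0); case: (b == 0) => //; case: ifP.
have T1 : 0 \in orth T := subgroup0 (orth_subgroup T).
have oE : (a \in orth T) = (b \in orth T).
  have [a0|a0] := boolP (a == 0).
    by have b0 := a0; rewrite zE in b0; rewrite (eqP a0) (eqP b0).
  by move: ab; rewrite /block_label -zE (negPf a0); do 2 case: ifP.
(* On [orth T] the label records neither membership in [S] nor the value of [g], but [orthT_S] fixes
   both. *)
have [sE gE] : (a \in S) = (b \in S) /\ g a = g b.
  have [aT|aT] := boolP (a \in orth T).
    have [-> ->] := orthT_S aT; rewrite oE in aT.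
    by have [-> ->] := orthT_S aT.
  have n0 x : x \notin orth T -> (x == 0) = false.
    by move=> xT; apply: contraNF xT => /eqP ->.
  move: ab; rewrite /block_label (n0 _ aT) (negPf aT); rewrite oE in aT.
  by rewrite (n0 _ aT) (negPf aT) => -[].
have fT D : subgroup D -> (a \in orth D) = (b \in orth D) ->
    \sum_(x in D) e (- dot a x) = \sum_(x in D) e (- dot b x).
  move=> sD abD; under eq_bigr => x _ do rewrite -dotNl.
  under [RHS]eq_bigr => x _ do rewrite -dotNl.
  by rewrite !sum_subgroup // !subgroupN ?abD //; apply: orth_subgroup.
have ET := fT T subT oE.
have EV : \sum_x e (- dot a x) = \sum_x e (- dot b x).
  under eq_bigr => x _ do rewrite -dotNl.
  under [RHS]eq_bigr => x _ do rewrite -dotNl.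
  by rewrite !sum_dot // !oppr_eq0 zE.
have S1 : 0 \in orth S := subgroup0 (orth_subgroup S).
have ES : \sum_(x in orth S) e (- dot a x) = \sum_(x in orth S) e (- dot b x).
  by apply: fT; [exact: orth_subgroup | rewrite !(orthK p_prime zP subS)].
have ETC : \sum_(x in ~: T) e (- dot a x) = \sum_(x in ~: T) e (- dot b x).
  move: EV; rewrite (bigID (mem T)) [RHS](bigID (mem T)) /= ET => /addrI.
  by under eq_bigl do rewrite -in_setC; under [RHS]eq_bigl do rewrite -in_setC.
case: l => [[[[] j]|]|].
- have EL : \sum_(x in [set x in T | f x == j]) e (- dot a x) =
      \sum_(x in [set x in T | f x == j]) e (- dot b x).
    by apply: sum_level_dual => //; rewrite !sumT sE gE.
  (* At j = 0 the points of [orth S] carry other labels; they form a subset of the level, so their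
     transform can be subtracted. *)
  have BE : [set x | lab x == Some (Some (true, j))] =
      [set x in T | f x == j] :\: (if j == 0 then orth S else set0).
    apply/setP => x; rewrite in_setD !in_set /block_label.
    have [->|x0] := eqVneq x 0.
      by rewrite f0 [0 == j]eq_sym; case: (j == 0); rewrite ?S1 ?andbF.
    have [xS|xS] := boolP (x \in orth S).
      have [xT fx] := orthS_T xS; rewrite fx xT [0 == j]eq_sym.
      by case: (j == 0); rewrite ?xS ?andbF.
    have -> : (x \in (if j == 0 then orth S else set0)) = false.
      by case: ifP => _; [rewrite (negPf xS) | rewrite in_set0].
    by case: (x \in T).
  have subL : (if j == 0 then orth S else set0) \subset [set x in T | f x == j].
    case: eqP => [->|_]; last exact: sub0set.
    by apply/subsetP => x /orthS_T[xT fx]; rewrite inE xT fx eqxx.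
  have EK : \sum_(x in if j == 0 then orth S else set0) e (- dot a x) =
      \sum_(x in if j == 0 then orth S else set0) e (- dot b x).
    by case: ifP => _ //; rewrite !big_set0.
  rewrite BE; move: EL; rewrite (big_setID (if j == 0 then orth S else set0)) /=.
  rewrite [RHS](big_setID (if j == 0 then orth S else set0)) /=.
  by rewrite (setIidPr subL) EK => /addrI.
- have BE : [set x | lab x == Some (Some (false, j))] = [set x in ~: T | f x == j].
    apply/setP => x; rewrite !in_set /block_label.
    have [->|x0] := eqVneq x 0; first by rewrite T0.
    have [/orthS_T[-> _] //|xS] := boolP (x \in orth S).
    by case: (x \in T).
  rewrite BE; apply: sum_level_dual => //; last by rewrite !sumTC sE gE.
  by move=> c x c0; rewrite !inE TZ.
- have BE : [set x | lab x == Some None] = orth S :\ 0.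
    apply/setP => x; rewrite in_setD1 in_set /block_label.
    by case: (x == 0) => //; case: (x \in orth S).
  move: ES; rewrite BE (big_setD1 0) //= [RHS](big_setD1 0) //= !dot0r.
  exact: addrI.
- have BE : [set x | lab x == None] = [set 0].
    apply/setP => x; rewrite in_set1 in_set /block_label.
    by case: (x == 0) => //; case: (x \in orth S).
  by rewrite BE !big_set1 !dot0r.
Qed.

Lemma half_sum : (n./2.+1 + n./2 = n)%N.
Proof. by rewrite addSn addnn -muln2; apply/esym/half_double. Qed.

(** An inclusion between sets of the same size: n - r and r - 1 are both (n - 1)/2. *)
Lemma orthS_level0 : r = n./2.+1 -> orth S = [set x in T | f x == 0].
Proof.
move=> rE; apply/eqP; rewrite eqEcard; apply/andP; split.
  by apply/subsetP => x /orthS_T[xT fx]; rewrite inE xT fx eqxx.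
rewrite -lez_nat levelT legendre0 mulr0 subr0 card_orthS rE /=.
by have -> : (n - n./2.+1 = n./2)%N by rewrite -[X in (X - _)%N]half_sum addKn.
Qed.

(** Here the level count is p^((n-1)/2) times 1 - (-1)^m [legendre j], which vanishes for exactly
    one of the two quadratic classes; the zero level is excluded because it is all of [orth S]. *)
Lemma sq_levels j : r = n./2.+1 ->
  (exists x, [/\ x \in T, x \notin orth S & f x = j]) <-> legendre j = - (-1) ^+ m.
Proof.
move=> rE.
have NE : #|[set x in T | f x == j]|%:Z = (p ^ n./2)%:Z * (1 - (-1) ^+ m * legendre j).
  by rewrite levelT rE /=; ring.
have ph : (p ^ n./2)%:Z != 0 by rewrite eqz_nat -lt0n expn_gt0 prime_gt0.
have orthE := orthS_level0 rE.
have ex : (exists x, [/\ x \in T, x \notin orth S & f x = j]) <->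
    (j != 0) && (#|[set x in T | f x == j]|%:Z != 0).
  split=> [[x [xT xS fx]]|/andP[j0]].
    rewrite orthE inE xT fx /= in xS; rewrite xS eqz_nat -lt0n.
    by apply/card_gt0P; exists x; rewrite inE xT fx eqxx.
  rewrite eqz_nat -lt0n => /card_gt0P[x]; rewrite inE => /andP[xT /eqP fx].
  by exists x; split=> //; rewrite orthE inE xT fx.
split=> [/ex/andP[j0]|H].
  rewrite NE mulf_eq0 (negPf ph) /= subr_eq0 -signr_odd /legendre (negPf j0).
  by case: ifP; case: odd.
apply/ex; rewrite NE mulf_eq0 (negPf ph) /= H mulrN -expr2 sqrr_sign opprK andbT.
by apply: contra_eqN H => /eqP ->; rewrite legendre0 eq_sym oppr_eq0 signr_eq0.
Qed.

(** The count in [levelS] carries no factor (-1)^m, so on the dual side the nonsquares survive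
    whatever p is modulo 4. *)
Lemma sq_levels_dual a : r = n./2.+1 -> a \in S -> a \notin orth T -> g a \in NSQ p.
Proof.
move=> rE aS aT.
have ph : (p ^ n./2)%:Z != 0 by rewrite eqz_nat -lt0n expn_gt0 prime_gt0.
have cT : #|orth T| = (p ^ n./2)%N.
  have := card_orth p_prime zP subT; rewrite cardT rE => E.
  have : (p ^ n = p ^ n./2.+1 * p ^ n./2)%N by rewrite -expnD half_sum.
  by rewrite -E => /eqP; rewrite eqn_pmul2l ?expn_gt0 ?prime_gt0 // => /eqP.
have orthE : orth T = [set x in S | g x == 0].
  apply/eqP; rewrite eqEcard; apply/andP; split.
    by apply/subsetP => x /orthT_S[xS gx]; rewrite inE xS gx dual0 eqxx.
  by rewrite -lez_nat levelS legendre0 mulr0 subr0 cT rE.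
have : #|[set x in S | g x == g a]|%:Z != 0.
  by rewrite eqz_nat -lt0n; apply/card_gt0P; exists a; rewrite inE aS eqxx.
rewrite orthE inE aS /= in aT; rewrite levelS rE /= -{1}[(p ^ _)%:Z]mulr1 -mulrBr.
rewrite mulf_eq0 (negPf ph) /= NSQ_legendre // /legendre (negPf aT).
by case: ifP.
Qed.

(** Now p^(r-1) exceeds both the deviation p^((n-1)/2) of a level count and the size p^(n-r) of
    [orth S]. *)
Lemma all_levels j : (n./2.+1 < r)%N ->
  exists x, [/\ x \in T, x \notin orth S & f x = j].
Proof.
move=> rE; have nE := half_double n_odd; have p1 := prime_gt1 p_prime.
have lt1 : (p ^ n./2 < p ^ r.-1)%N by rewrite ltn_exp2l //; lia.
have lt2 : (p ^ (n - r) < p ^ r.-1)%N by rewrite ltn_exp2l //; lia.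
suff : (0 < #|[set x in T | f x == j] :\: orth S|)%N.
  by case/card_gt0P => x; rewrite in_setD inE => /and3P[xS xT /eqP fx]; exists x.
have [->|j0] := eqVneq j 0.
  have lv := levelT 0; rewrite legendre0 mulr0 subr0 in lv; case: lv => lv.
  rewrite cardsD subn_gt0 lv (leq_ltn_trans _ lt2) // -card_orthS.
  exact/subset_leq_card/subsetIr.
have -> : [set x in T | f x == j] :\: orth S = [set x in T | f x == j].
  apply/setP => x; rewrite in_setD; have [/orthS_T[_ fx]|//] := boolP (x \in orth S).
  by rewrite inE fx eq_sym (negPf j0) andbF.
rewrite -ltz_nat levelT -signr_odd /legendre (negPf j0).
case: ifP => _; case: odd; rewrite ?expr0 ?expr1; clear -lt1; lia.
Qed.

End DualPair.

(** * Bent functions in DBF *)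

Section BentSchemes.
Variables (R : realType) (p n : nat).
Hypotheses (p_prime : prime p) (p_odd : odd p) (n_odd : odd n).
Local Notation V := 'rV['F_p]_n.
Local Notation z := (xi R p).
Local Notation e := (@zchar R[i] p z).
Local Notation m := p./2.
Local Notation G := (p%:R ^+ n./2 * gauss p z).
Implicit Types (f : V -> 'F_p).

Let zP : p.-primitive_root z := xi_prim R p_prime.

(** As n is odd, p^n and p agree modulo 4, so [mu] is the phase of the Gauss sum. The exact sign
    makes [Bminus] the set where the sign relative to G is - 1. *)
Lemma mu_sqrt_pn : mu R p n * sqrt_pn R p n = G.
Proof.
rewrite gauss_value // mulrCA /mu /gauss_phase; congr (_ * _).
  have sq1 : (p ^ 2 = 1 %[mod 4])%N.
    have := half_double p_odd; move: (p./2) => k ->; rewrite -addn1 sqrnD.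
    by rewrite expnMn; lia.
  rewrite {1}(half_double n_odd) expnS mulnC [(_ * 2)%N]mulnC expnM.
  by rewrite -modnMml -modnXm sq1 modnXm exp1n modnMml mul1n.
have p0 : 0 <= p%:R :> R by rewrite ler0n.
rewrite /sqrt_pn {1}(half_double n_odd) exprSr exprM sqrtrM ?sqr_ge0 //.
by rewrite sqrtr_sqr ger0_norm ?exprn_ge0 // rmorphM rmorphXn /= rmorph_nat.
Qed.

(** [ev_modulus] guarantees that the search in [dual] succeeds; the two signs exclude each other
    because the value is nonzero. *)
Lemma walsh_dual f : bent R f ->
  (forall a, walsh R f a = (-1) ^+ (a \in Bminus R f) * G * e (dual R f a)) /\
  Bplus R f = ~: Bminus R f.
Proof.
move=> fb; have G0 : G != 0 := G_neq0 p_prime p_odd n_odd zP.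
have dE a : walsh R f a = G * e (dual R f a) \/ walsh R f a = - (G * e (dual R f a)).
  have [q qE] := ev_unfold z (fun j : 'F_p => #|[set x in setT | f x - dot a x == j]|%:Z).
  have wE : walsh R f a = horner_morph (fun k : int => mulrC (z - 1) k%:~R) q.
    rewrite qE -sum_level.
    by apply: eq_bigl => x; rewrite inE.
  have [|s [k kE]] := ev_modulus p_prime p_odd n_odd zP (y := q).
    rewrite -wE -normCK fb -rmorphXn /= sqr_sqrtr ?exprn_ge0 ?ler0n //.
    by rewrite rmorphXn /= rmorph_nat.
  rewrite /dual; case: pickP => [j|/(_ k)] /=; rewrite !mu_sqrt_pn.
    by case/orP => /eqP; [left | right].
  rewrite wE kE => /norP[]; case: s {kE}.
    by rewrite expr1 mulN1r mulNr eqxx.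
  by rewrite expr0 mul1r eqxx.
have dis a : (walsh R f a == G * e (dual R f a)) = ~~ (walsh R f a == - (G * e (dual R f a))).
  have Ge : G * e (dual R f a) != 0 by rewrite mulf_neq0 // zchar_neq0.
  have opp : (G * e (dual R f a) == - (G * e (dual R f a))) = false.
    rewrite -subr_eq0 opprK -mulr2n mulrn_eq0; exact: negbTE.
  by case: (dE a) => ->; rewrite !eqxx ?opp // eq_sym opp.
split=> [a|].
  rewrite inE mu_sqrt_pn; case: eqP => [->|/eqP]; first by rewrite expr1 mulN1r mulNr.
  by rewrite -dis => /eqP ->; rewrite mul1r.
by apply/setP => a; rewrite in_setC !inE mu_sqrt_pn dis.
Qed.

Lemma nondeg_subspaceE r (B : {set V}) : nondeg_subspace r B ->
  [/\ subgroup B, #|B| = (p ^ r)%N & forall a x, a != 0 -> (a *: x \in B) = (x \in B)].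
Proof.
move=> [[W [-> dW]] _]; split.
- split; first by rewrite inE mem0v.
  by move=> x y; rewrite !inE; apply: rpredB.
- by rewrite cardsE card_vspace card_Fp // dW.
- by move=> a x a0; rewrite !inE rpredZeq (negPf a0).
Qed.

(** As p - 1 is even and prime to h - 1, the degree h is even. *)
Lemma DBF_even f x : DBF R f -> f (- x) = f x.
Proof.
move=> [_ _ [h [h0 hp hf]]]; rewrite -scaleN1r hf ?oppr_eq0 ?oner_eq0 //.
rewrite -signr_odd; suff -> : odd h = false by rewrite expr0 mul1r.
apply/negP => oh; have : (2 %| gcdn (h - 1) (p - 1))%N.
  by rewrite dvdn_gcd !dvdn2 !oddB ?oh ?p_odd // prime_gt0.
by rewrite hp.
Qed.

(** The scalar [a] solves a^(h-1) = y: raising to the power h - 1 is invertible on the nonzero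
    scalars, and Bezout gives the inverse exponent. *)
Lemma DBF_scale f y : DBF R f -> y != 0 ->
  exists2 a, a != 0 & forall x, y * f x = a^-1 * f (a *: x).
Proof.
move=> [_ _ [h [h0 hp hf]]] y0.
have [u uE] : exists u, (y ^+ u) ^+ (h - 1) = y.
  (* If h = 1, the gcd is p - 1, which is at least 2. *)
  have [h1|h1] := posnP (h - 1).
    by move: hp; rewrite h1 gcd0n; have := half_double p_odd; have := half_gt0 p_prime p_odd; lia.
  case: (egcdnP (p - 1) h1) => u v uE _; exists u.
  rewrite -exprM uE hp addn1 exprS; have -> : (p - 1 = m * 2)%N.
    by have := half_double p_odd; lia.
  by rewrite mulnC exprM Fp_expr // expr1n mulr1.
exists (y ^+ u) => [|x]; first by rewrite expf_neq0.
rewrite hf ?expf_neq0 // mulrA -[in LHS]uE; congr (_ * _).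
apply: (mulfI (expf_neq0 u y0)); rewrite mulrA mulfV ?expf_neq0 // mul1r -exprS.
by rewrite subn1 prednK.
Qed.

Variables (f : V -> 'F_p) (S : {set V}) (r : nat).
Local Notation g := (dual R f).
Local Notation T := (Bminus R g).
Hypothesis f_DBF : DBF R f.
Hypothesis walshS : forall a,
  walsh R f a = (-1) ^+ (a \in S) * ((-1) ^+ m * G) * e (g a).
Hypotheses (nS : nondeg_subspace r S) (nT : nondeg_subspace r T).
Hypotheses (r_half : (n./2 < r)%N) (r_lt : (r < n)%N).
Local Notation lab := (block_label (orth S) T f).
Local Notation lab' := (block_label (orth T) S g).

Let subS : subgroup S. Proof. by have [] := nondeg_subspaceE nS. Qed.
Let subT : subgroup T. Proof. by have [] := nondeg_subspaceE nT. Qed.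
Let cardS : #|S| = (p ^ r)%N. Proof. by have [] := nondeg_subspaceE nS. Qed.
Let cardT : #|T| = (p ^ r)%N. Proof. by have [] := nondeg_subspaceE nT. Qed.
Let TZ a x : a != 0 -> (a *: x \in T) = (x \in T).
Proof. by have [_ _] := nondeg_subspaceE nT; apply. Qed.
Let TN x : (- x \in T) = (x \in T). Proof. exact: subgroupN. Qed.
Let f0 : f 0 = 0. Proof. by have [_] := f_DBF. Qed.
Let fN x : f (- x) = f x. Proof. exact: DBF_even. Qed.
Let fhom y : y != 0 -> exists2 a, a != 0 & forall x, y * f x = a^-1 * f (a *: x).
Proof. exact: DBF_scale. Qed.

Let bent_dual : bent R g. Proof. by have [[]] := f_DBF. Qed.
Let walshT := (walsh_dual bent_dual).1.
Let sumS := sum_S p_prime p_odd n_odd zP walshS walshT TN.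
Let sumT := sum_T p_prime p_odd n_odd zP walshS walshT TN.
Let sumTC := sum_TC p_prime p_odd n_odd zP walshS walshT TN.

Lemma label_scheme (D D' : {set 'F_p}) d :
  (forall j, reflect (exists x, [/\ x \in T, x \notin orth S & f x = j]) (j \in D)) ->
  (forall x, lab' x \in labels D') -> #|D'| = #|D| -> (p + #|D|).+1 = d ->
  partition (fibers (labels D) lab) [set: V] /\ induces_sym_scheme d (fibers (labels D) lab).
Proof.
move=> DP labD' cD dE.
have im := block_label_im p_prime p_odd n_odd zP sumS sumTC subS subT cardS cardT f0 r_lt DP.
split; first exact: fibers_partition.
apply: (fibers_scheme p_prime zP im (D' := labels D') (lab' := lab')) => //.
- by rewrite card_labels card_Fp // dE.
- by rewrite !card_labels cD.
- exact: block_label0.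
- exact: block_labelN.
- by move=> l a b; apply: (labels_dual p_prime p_odd n_odd zP sumS sumT sumTC).
Qed.

Lemma fibers_labels (D : {set 'F_p}) : fibers (labels D) lab =
  [set [set 0]] :|: [set cset R f j | j : 'F_p] :|: [set orth S :\ 0]
    :|: [set dset R f j :\: (if j == 0 then orth S else set0) | j in D].
Proof.
have S1 : 0 \in orth S := subgroup0 (orth_subgroup S).
have oST x := orthS_T p_prime p_odd n_odd zP sumS subT f0 (x := x).
have T0 : 0 \in T := subgroup0 subT.
have [_ TC] := walsh_dual bent_dual.
rewrite /fibers labelsE !imsetU !imset_set1 -!imset_comp.
have b0 : [set x | lab x == None] = [set 0].
  apply/setP => x; rewrite in_set1 in_set /block_label.
  by case: (x == 0) => //; case: (x \in orth S).
have b1 : [set x | lab x == Some None] = orth S :\ 0.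
  apply/setP => x; rewrite in_setD1 in_set /block_label.
  by case: (x == 0) => //; case: (x \in orth S).
have b2 j : [set x | lab x == Some (Some (false, j))] = cset R f j.
  rewrite /cset TC; apply/setP => x; rewrite in_set [RHS]in_set in_setC /block_label.
  have [->|x0] := eqVneq x 0; first by rewrite T0.
  have [/oST[-> _] //|xS] := boolP (x \in orth S).
  by case: (x \in T).
have b3 j : [set x | lab x == Some (Some (true, j))] =
    dset R f j :\: (if j == 0 then orth S else set0).
  apply/setP => x; rewrite in_setD in_set [x \in dset _ _ _]in_set /block_label.
  have [->|x0] := eqVneq x 0.
    by rewrite f0 [0 == j]eq_sym; case: (j == 0); rewrite ?S1 ?andbF.
  have [xS|xS] := boolP (x \in orth S).
    have [xT fx] := oST _ xS; rewrite fx xT [0 == j]eq_sym.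
    by case: (j == 0); rewrite ?xS ?andbF.
  have -> : (x \in (if j == 0 then orth S else set0)) = false.
    by case: ifP => _; [rewrite (negPf xS) | rewrite in_set0].
  by case: (x \in T).
rewrite b0 b1; congr (_ :|: _ :|: _ :|: _).
- by apply: eq_imset => j /=; rewrite b2.
- by apply: eq_imset => j /=; rewrite b3.
Qed.

Lemma half_rank_scheme (D : {set 'F_p}) : r = n./2.+1 ->
  (forall j, (j \in D) = (legendre j == - (-1) ^+ m)) -> #|D| = m ->
  let P := [set [set 0]] :|: [set cset R f j | j : 'F_p] :|: [set dset R f 0 :\ 0]
    :|: [set dset R f j | j in D] in
  partition P [set: V] /\ induces_sym_scheme ((3 * p + 1) %/ 2)%N P.
Proof.
move=> rE DE cD P.
have orthE : orth S = dset R f 0.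
  exact: (orthS_level0 p_prime p_odd n_odd zP sumS sumT subS subT cardS cardT f0 fN r_half r_lt rE).
have DP j : reflect (exists x, [/\ x \in T, x \notin orth S & f x = j]) (j \in D).
  by rewrite DE; apply: (iffP eqP) => H;
    apply/(sq_levels p_prime p_odd n_odd zP sumS sumT subS subT cardS cardT f0 fN
      r_half r_lt j rE).
have -> : P = fibers (labels D) lab.
  rewrite fibers_labels /P -orthE; congr (_ :|: _); apply: eq_in_imset => j jD.
  case: eqP => [j0|_]; last by rewrite setD0.
  by move: jD; rewrite DE j0 legendre0 eq_sym oppr_eq0 signr_eq0.
(* The dual labels use the nonsquares in both cases; [D] and [NSQ p] have m elements each, and p + m
   + 1 = (3p + 1)/2. *)
apply: (label_scheme DP (D' := NSQ p)).
- move=> x; rewrite inE /block_label; case: ifP => // _; case: ifP => // xT.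
  case: ifP => // xS.
  apply: (sq_levels_dual p_prime p_odd n_odd zP sumS sumT subS subT cardS cardT f0 fN r_half) => //.
  by rewrite xT.
- by rewrite cD card_NSQ.
- by rewrite cD; have := half_double p_odd; lia.
Qed.

Lemma large_rank_scheme : (n./2.+1 < r)%N ->
  let P := [set [set 0]] :|: [set cset R f j | j : 'F_p] :|: [set orth S :\ 0]
    :|: [set dset R f 0 :\: orth S] :|: [set dset R f j | j : 'F_p & j != 0] in
  partition P [set: V] /\ induces_sym_scheme (2 * p + 1)%N P.
Proof.
move=> rE P.
have DP j : reflect (exists x, [/\ x \in T, x \notin orth S & f x = j]) (j \in [set: 'F_p]).
  apply: (iffP idP) => [_|_]; last by rewrite inE.
  exact: (all_levels p_prime p_odd n_odd zP sumS sumT subS subT cardS cardT f0 fN r_half r_lt).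
have -> : P = fibers (labels [set: 'F_p]) lab.
  rewrite fibers_labels /P -setUA; congr (_ :|: _).
  have -> : [set: 'F_p] = 0 |: [set j | j != 0].
    by apply/setP => j; rewrite !inE; case: (j == 0).
  rewrite imsetU1 eqxx; congr (_ |: _).
  have -> : [set dset R f j | j : 'F_p & j != 0] = [set dset R f j | j in [set j : 'F_p | j != 0]].
    by apply/setP => A; apply/imsetP/imsetP => -[j j0 ->]; exists j; rewrite ?inE in j0 *.
  by apply: eq_in_imset => j; rewrite inE => /negPf ->; rewrite setD0.
apply: (label_scheme DP (D' := setT)) => //.
- move=> x; rewrite inE /block_label; case: eqP => // _.
  by case: (x \in orth T) => //; case: (x \in S); rewrite ?inE.
- by rewrite cardsT card_Fp //; lia.
Qed.

End BentSchemes.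

Theorem theorem4 (R : realType) (p n r : nat) (p_prime : prime p)
    (p_odd : odd p) (n_ge3 : (3 <= n)%N) (n_odd : odd n)
    (f : 'rV['F_p]_n -> 'F_p)
    (f_nwr : non_weakly_regular R f) (f_DBF : DBF R f)
    (f_sub1 : (p = 1 %[mod 4])%N ->
       nondeg_subspace r (Bminus R f) /\
       nondeg_subspace r (Bminus R (dual R f)))
    (f_sub3 : (p = 3 %[mod 4])%N ->
       nondeg_subspace r (Bplus R f) /\
       nondeg_subspace r (Bminus R (dual R f))) :
  [/\ r = ((n + 1) %/ 2)%N -> (p = 1 %[mod 4])%N ->
        partition (U14 R f) [set: 'rV['F_p]_n] /\
        induces_sym_scheme ((3 * p + 1) %/ 2)%N (U14 R f),
      r = ((n + 1) %/ 2)%N -> (p = 3 %[mod 4])%N ->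
        partition (U15 R f) [set: 'rV['F_p]_n] /\
        induces_sym_scheme ((3 * p + 1) %/ 2)%N (U15 R f),
      ((n + 1) %/ 2 < r <= n - 1)%N -> (p = 1 %[mod 4])%N ->
        partition (U16 R f) [set: 'rV['F_p]_n] /\
        induces_sym_scheme (2 * p + 1)%N (U16 R f) &
      ((n + 1) %/ 2 < r <= n - 1)%N -> (p = 3 %[mod 4])%N ->
        partition (U17 R f) [set: 'rV['F_p]_n] /\
        induces_sym_scheme (2 * p + 1)%N (U17 R f)].

Proof.
have pE := half_double p_odd; have nE := half_double n_odd.
have [fb _] := f_nwr; have [wf BpE] := walsh_dual p_prime p_odd n_odd fb.
split=> [rE p4|rE p4|/andP[r1 r2] p4|/andP[r1 r2] p4].
- have [nS nT] := f_sub1 p4; have om : odd p./2 = false by lia.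
  have s1 : (-1) ^+ p./2 = 1 :> R[i] by rewrite -signr_odd om.
  apply: (half_rank_scheme p_prime p_odd n_odd f_DBF _ nS nT); rewrite ?card_NSQ //; try lia.
    by move=> a; rewrite s1 mul1r.
  by move=> j; rewrite NSQ_legendre // -[_ ^+ p./2]signr_odd om.
- have [nS nT] := f_sub3 p4; have om : odd p./2 by lia.
  have s1 : (-1) ^+ p./2 = -1 :> R[i] by rewrite -signr_odd om.
  apply: (half_rank_scheme p_prime p_odd n_odd f_DBF _ nS nT); rewrite ?card_SQ //; try lia.
    move=> a; rewrite s1 BpE in_setC wf; case: (a \in _); rewrite ?expr0 ?expr1 /=; ring.
  by move=> j; rewrite SQ_legendre // -[_ ^+ p./2]signr_odd om opprK.
- have [nS nT] := f_sub1 p4; have om : odd p./2 = false by lia.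
  have s1 : (-1) ^+ p./2 = 1 :> R[i] by rewrite -signr_odd om.
  apply: (large_rank_scheme p_prime p_odd n_odd f_DBF _ nS nT); try lia.
  by move=> a; rewrite s1 mul1r.
- have [nS nT] := f_sub3 p4; have om : odd p./2 by lia.
  have s1 : (-1) ^+ p./2 = -1 :> R[i] by rewrite -signr_odd om.
  apply: (large_rank_scheme p_prime p_odd n_odd f_DBF _ nS nT); try lia.
  move=> a; rewrite s1 BpE in_setC wf; case: (a \in _); rewrite ?expr0 ?expr1 /=; ring.
Qed.
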